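(* Let $G$ and $H$ be Polish groups, let $X$ be a Polish $G$-space and let $Y$ be a Polish $H$-space. Let $n\in\{0,1,2,\ldots\}\cup\{\infty\}$. (1) If $X$ is generically $n$-dimensional and the dimension of $Y$ is less than $n$, then $E^G_X$ does not $*$-reduce to $E^H_Y$. (2) If the dimension of $X$ is less than $n$ and $Y$ is locally generically $n$-dimensional, then $E^G_X$ does not $*$-reduce to $E^H_Y$.
   Context: Polish spaces are taken to be non-empty. A Polish $G$-space is a Polish space $X$ with a continuous action of the Polish group $G$; $E^G_X$ is its orbit equivalence relation and $[x]$ the orbit of $x$. A map $f\colon X\to Y$ between Polish spaces is Baire measurable if preimages of open sets have the Baire property, and category preserving if preimages of meager sets are meager. $E$ on $X$ $*$-reduces to $F$ on $Y$ if there is a Baire measurable category preserving map $f\colon X\to Y$ such that $x\,E\,x'\iff f(x)\,F\,f(x')$ for all $x,x'\in X$. A sequence $(g_n)$ in $G$ is right-Cauchy if it is Cauchy for some (equivalently, any) compatible right-invariant metric. In a Polish $G$-space $X$, $x$ right-embeds in $x'$ if there is a right-Cauchy sequence $(g_n)$ in $G$ with $g_nx'\to x$. For $G$-invariant $C\subseteq X$, $\mathcal{B}(C/G)$ is the digraph whose vertices are the orbits $[x]$, $x\in C$, with an arrow $[x]\to[x']$ iff $x$ right-embeds in $x'$. The combinatorial $m$-cube ($m\ge 0$) is the digraph on the powerset of $\{0,\dots,m-1\}$ with an arrow $\sigma\to\tau$ iff $\sigma\subseteq\tau$. A digraph embedding is an injection that preserves and reflects arrows. For a non-empty $G$-invariant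 $C\subseteq X$, the dimension of $C$ is the largest $m\geq0$ such that the combinatorial $m$-cube embeds in $\mathcal{B}(C/G)$ if such a largest $m$ exists, and $\infty$ otherwise. $X$ is generically $n$-dimensional if $n$ is the largest element of $\{0,1,\dots\}\cup\{\infty\}$ such that every invariant comeager subset of $X$ has dimension at least $n$. $X$ is locally generically $n$-dimensional if $n$ is the largest element of $\{0,1,\dots\}\cup\{\infty\}$ such that every invariant non-meager subset of $X$ with the Baire property has dimension at least $n$. *)

(* Defs.v *)
From HB Require Import structures.
From mathcomp Require Import all_boot all_order all_algebra monoid.
From mathcomp Require Import boolp classical_sets functions cardinality.
From mathcomp Require Import reals topology.

Set Implicit Arguments.
Unset Strict Implicit.
Unset Printing Implicit Defensive.

Import Order.TTheory GRing.Theory Num.Theory.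
Local Open Scope classical_set_scope.
Local Open Scope ring_scope.

Section metrics.
Context (R : realType).

(* Metrics are plain functions rather than [metricType] structures, since a
   Polish space carries a topology but no distinguished metric. *)
Record is_metric (T : Type) (d : T -> T -> R) : Prop := IsMetric {
  metric_refl : forall x, d x x = 0;
  metric_separated : forall x y, d x y = 0 -> x = y;
  metric_symmetric : forall x y, d x y = d y x;
  metric_triangular : forall x y z, d x z <= d x y + d y z }.

Definition compatible_metric (T : topologicalType) (d : T -> T -> R) : Prop :=
  is_metric d /\
  forall (x : T) (A : set T),
    nbhs x A <-> exists2 e, 0 < e & [set y | d x y < e] `<=` A.

Definition cauchy_seq (T : Type) (d : T -> T -> R) (u : nat -> T) : Prop :=
  forall e, 0 < e ->
    exists N : nat, forall i j, (N <= i)%N -> (N <= j)%N -> d (u i) (u j) < e.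

Definition complete_metric (T : topologicalType) (d : T -> T -> R) : Prop :=
  forall u : nat -> T, cauchy_seq d u -> exists l : T, u @ \oo --> l.

Definition polish (T : topologicalType) : Prop :=
  [/\ [set: T] !=set0,
      exists2 D : set T, countable D & dense D
    & exists2 d : T -> T -> R, compatible_metric d & complete_metric d].

End metrics.

Section category.
Context (T : topologicalType).
Implicit Types A : set T.

Definition nowhere_dense A := (closure A)° = set0.

Definition meager A := exists2 F : nat -> set T,
  forall i, nowhere_dense (F i) & A `<=` \bigcup_i F i.

Definition comeager A := meager (~` A).

Definition baire_property A := exists2 U : set T, open U & meager (A `+` U).

End category.

Definition baire_measurable (X Y : topologicalType) (f : X -> Y) : Prop :=
  forall U : set Y, open U -> baire_property (f @^-1` U).

Definition category_preserving (X Y : topologicalType) (f : X -> Y) : Prop :=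
  forall M : set Y, meager M -> meager (f @^-1` M).

Definition star_reduces (X Y : topologicalType)
    (E : X -> X -> Prop) (F : Y -> Y -> Prop) : Prop :=
  exists f : X -> Y, [/\ baire_measurable f, category_preserving f
    & forall x x', E x x' <-> F (f x) (f x')].

HB.mixin Record isTopologicalGroup G & Topological G & Group G := {
  mulg_continuous : continuous (fun p : G * G => (p.1 * p.2)%g);
  invg_continuous : continuous (fun g : G => (g^-1)%g) }.

#[short(type="topologicalGroupType")]
HB.structure Definition TopologicalGroup :=
  {G of Topological G & Group G & isTopologicalGroup G}.

Record continuous_action (G : topologicalGroupType) (X : topologicalType) :=
  ContinuousAction {
    act :> G -> X -> X;
    act1x : forall x, act 1%g x = x;
    actMx : forall g h x, act (g * h)%g x = act g (act h x);
    act_continuous : continuous (fun p : G * X => act p.1 p.2) }.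

Section actions.
Context (G : topologicalGroupType) (X : topologicalType).
Context (a : continuous_action G X).

Definition gorbit (x : X) : set X := [set a g x | g in [set: G]].

Definition orbit_rel (x x' : X) : Prop := gorbit x x'.

Definition invariant (C : set X) : Prop := forall g x, C x -> C (a g x).

End actions.

Record digraph := Digraph { vertex :> Type; arrow : vertex -> vertex -> Prop }.

Definition digraph_embeds (D E : digraph) : Prop :=
  exists f : D -> E,
    injective f /\ forall u v : D, arrow u v <-> arrow (f u) (f v).

Definition cube (m : nat) : digraph :=
  @Digraph {set 'I_m} (fun s t => is_true (s \subset t)).

Inductive enat := Fin of nat | Infty.

Definition enat_le (m n : enat) : bool :=
  match m, n with
  | _, Infty => true
  | Infty, Fin _ => false
  | Fin i, Fin j => (i <= j)%N
  end.

Definition enat_lt (m n : enat) : bool := ~~ enat_le n m.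

Definition largest (P : enat -> Prop) (n : enat) : Prop :=
  P n /\ forall k, P k -> enat_le k n.

Section dimensions.
Context (R : realType).

Definition right_cauchy (G : topologicalGroupType) (u : nat -> G) : Prop :=
  exists d : G -> G -> R,
    [/\ compatible_metric d,
        forall g h k : G, d (g * k)%g (h * k)%g = d g h
      & cauchy_seq d u].

Context (G : topologicalGroupType) (X : topologicalType).
Context (a : continuous_action G X).

Definition right_embeds (x x' : X) : Prop :=
  exists2 u : nat -> G, right_cauchy u & (fun i => a (u i) x') @ \oo --> x.

(* Right-embeddability does not depend on the representatives of the orbits,
   so asking for some representatives is the same as asking for all. *)
Definition orbit_digraph (C : set X) : digraph :=
  @Digraph (set_type [set gorbit a x | x in C])
    (fun O O' => exists x x', [/\ val O = gorbit a x, val O' = gorbit a x'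
                                & right_embeds x x']).

Definition is_largest_cube (C : set X) (m : nat) : Prop :=
  digraph_embeds (cube m) (orbit_digraph C) /\
  forall k, digraph_embeds (cube k) (orbit_digraph C) -> (k <= m)%N.

(* Meaningful for non-empty invariant [C] only. *)
Definition dimension (C : set X) : enat :=
  match pselect (exists m, is_largest_cube C m) with
  | left ex => Fin (projT1 (cid ex))
  | right _ => Infty
  end.

Definition generically_dimensional (n : enat) : Prop :=
  largest (fun k => forall C : set X,
    invariant a C -> comeager C -> enat_le k (dimension C)) n.

Definition locally_generically_dimensional (n : enat) : Prop :=
  largest (fun k => forall C : set X,
    invariant a C -> ~ meager C -> baire_property C ->
    enat_le k (dimension C)) n.

End dimensions.

Arguments right_embeds R {G X} a x x'.
Arguments orbit_digraph R {G X} a C.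
Arguments dimension R {G X} a C.
Arguments generically_dimensional R {G X} a n.
Arguments locally_generically_dimensional R {G X} a n.

(* Main.v *)
(** If [f] is a Baire measurable homomorphism of orbit equivalence relations,
    then [x -> x'] implies [f x -> f x'] on an invariant comeager set of [x] and
    [x'].  Indeed a measurable selection gives a Baire measurable cocycle [h]
    with [f (g x) = h (g, x) (f x)] generically; [h] is continuous on a comeager
    set, so for generic [y] near a generic point and generic [g] near [1], the
    point [f (g y)] is a small translate of [f y].  Along a right-Cauchy
    sequence moving [x'] to [x] these small translations multiply to a
    right-Cauchy sequence moving [f x'] to [f x].

    A *-reduction [f] also has a Baire measurable inverse on the saturation of
    the image of a comeager set, again by measurable selection, and the same
    argument applies to this inverse.  Because [f] is category preserving, the
    saturation is non-meager and the generic set for the inverse pulls back to a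
    comeager set.  Thus [f] is an isomorphism between the digraphs of an
    invariant comeager subset of [X] and of an invariant non-meager subset of
    [Y] with the Baire property, and cubes can be moved both ways. *)
Require Import Defs.
From mathcomp Require Import all_boot all_order all_algebra.
From mathcomp Require Import boolp classical_sets reals topology.
From mathcomp Require Import monoid functions cardinality lra.
Local Open Scope classical_set_scope.

Set Implicit Arguments.
Unset Strict Implicit.
Unset Printing Implicit Defensive.
Import Order.TTheory GRing.Theory Num.Theory.
Local Open Scope ring_scope.

(** * Meager sets and the Baire property *)

Section meager_sets.
Context {T : topologicalType}.
Implicit Types A B O : set T.

Lemma nowhere_denseP A :
  nowhere_dense A <-> forall O, open O -> O `<=` closure A -> O = set0.
Proof.
split=> [A0 O oO OA|h]; last first.
  by apply: h; [exact: open_interior|exact: interior_subset].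
by rewrite -subset0 => x Ox; rewrite -A0; apply: filterS OA _; exact: open_nbhs_nbhs.
Qed.

Lemma meagerS A B : A `<=` B -> meager B -> meager A.
Proof. by move=> AB [F nF BF]; exists F => //; exact: subset_trans BF. Qed.

Lemma meager_bigcup (I : countType) (F : I -> set T) :
  (forall i, meager (F i)) -> meager (\bigcup_i F i).
Proof.
move=> mF; have /choice[N hN] i : exists N : nat -> set T,
    (forall j, nowhere_dense (N j)) /\ F i `<=` \bigcup_j N j.
  by have [N h1 h2] := mF i; exists N.
exists (fun k => if unpickle k is Some (i, j) then N i j else set0).
  move=> k; case: unpickle => [[i j]|]; first exact: (hN i).1.
  by rewrite /nowhere_dense closure0 interior0.
move=> x [i _ /(hN i).2[j _ Nx]].
by exists (pickle (i, j)) => //; rewrite pickleK.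
Qed.

Lemma meager0 : meager (set0 : set T).
Proof. by exists (fun=> set0) => // i; rewrite /nowhere_dense closure0 interior0. Qed.

Lemma meagerU A B : meager A -> meager B -> meager (A `|` B).
Proof.
move=> mA mB; apply: (@meagerS _ (\bigcup_(b : bool) if b then A else B)).
  by move=> x [Ax|Bx]; [exists true|exists false].
by apply: meager_bigcup => -[].
Qed.

Lemma comeagerS A B : A `<=` B -> comeager A -> comeager B.
Proof. by move=> /subsetC; exact: meagerS. Qed.

Lemma comeagerT : comeager [set: T].
Proof. by rewrite /comeager setCT; exact: meager0. Qed.

Lemma comeagerI A B : comeager A -> comeager B -> comeager (A `&` B).
Proof. by move=> cA cB; rewrite /comeager setCI; exact: meagerU. Qed.

Lemma comeager_bigcap (I : countType) (F : I -> set T) :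
  (forall i, comeager (F i)) -> comeager (\bigcap_i F i).
Proof. by move=> cF; rewrite /comeager setC_bigcap; exact: meager_bigcup. Qed.

Lemma comeager_open_dense O :
  open O -> (forall U, open U -> U !=set0 -> O `&` U !=set0) -> comeager O.
Proof.
move=> oO dO; exists (fun=> ~` O); last by move=> x Ox; exists 0%N.
move=> _; apply/nowhere_denseP => U oU.
rewrite closure_setC (_ : O° = O); last exact/interior_id.
move=> UO; apply/eqP; case: (eqVneq U set0) => // /set0P /(dO _ oU)[x [Ox /UO]].
by [].
Qed.

Lemma open_baire_property O : open O -> baire_property O.
Proof. by move=> oO; exists O => //; rewrite setYK; exact: meager0. Qed.

Lemma baire_property_ae A B N :
  meager N -> (forall x, ~ N x -> A x <-> B x) ->
  baire_property B -> baire_property A.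
Proof.
move=> mN AB [U oU mU]; exists U => //.
apply: (meagerS _ (meagerU mU mN)) => x.
have [Nx|/AB ABx] := pselect (N x); first by right.
by move=> [[/ABx Bx nU]|[Ux nA]]; left; [left|right; split => // /ABx].
Qed.

Lemma meager_baire_property A : meager A -> baire_property A.
Proof.
move=> mA; apply: (baire_property_ae (B := set0) mA); first by [].
by apply: open_baire_property; exact: open0.
Qed.

(* The boundary of an open set is nowhere dense. *)
Lemma baire_propertyC A : baire_property A -> baire_property (~` A).
Proof.
move=> [U oU mU].
have mb : meager (~` (~` U)° `\` U).
  apply: (@meagerS _ (~` (U `|` (~` U)°))).
    by move=> x [? ?] -[].
  apply: comeager_open_dense => [|V oV [x Vx]].
    by apply: openU => //; exact: open_interior.
  have [[y [Uy Vy]]|UV] := pselect (U `&` V !=set0).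
    by exists y; split => //; left.
  exists x; split => //; right; apply: filterS (open_nbhs_nbhs (conj oV Vx)).
  by move=> y Vy Uy; apply: UV; exists y.
apply: (baire_property_ae (B := (~` U)°) (meagerU mU mb)); last first.
  by apply: open_baire_property; exact: open_interior.
move=> x /not_orP[/not_orP[h1 h2] nx].
split=> [nA|/interior_subset nU Ax]; last by apply: h1.
by apply: contrapT => h; apply: nx; split => // Ux; apply: h2.
Qed.

Lemma baire_property_bigcup (I : countType) (F : I -> set T) :
  (forall i, baire_property (F i)) -> baire_property (\bigcup_i F i).
Proof.
move=> bF; have /choice[U hU] i : exists U, open U /\ meager (F i `+` U).
  by have [U ? ?] := bF i; exists U.
apply: (baire_property_ae (B := \bigcup_i U i)
    (meager_bigcup (fun i => (hU i).2))); last first.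
  by apply: open_baire_property; apply: bigcup_open => i _; exact: (hU i).1.
move=> x nx; split=> -[i _ xi]; exists i => //; apply: contrapT => h; apply: nx;
  exists i => //; by [left|right].
Qed.

Lemma baire_propertyU A B :
  baire_property A -> baire_property B -> baire_property (A `|` B).
Proof.
move=> bA bB; rewrite (_ : A `|` B = \bigcup_(b : bool) if b then A else B).
  by apply: baire_property_bigcup => -[].
apply/seteqP; split => x; first by move=> [Ax|Bx]; [exists true|exists false].
by move=> [[] _ ?]; [left|right].
Qed.

Lemma baire_propertyI A B :
  baire_property A -> baire_property B -> baire_property (A `&` B).
Proof.
move=> bA bB; rewrite -(setCK (A `&` B)) setCI; apply: baire_propertyC.
by apply: baire_propertyU; exact: baire_propertyC.
Qed.

Lemma baire_propertyD A B :
  baire_property A -> baire_property B -> baire_property (A `\` B).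
Proof.
by move=> bA bB; rewrite setDE; apply: baire_propertyI => //; exact: baire_propertyC.
Qed.

End meager_sets.

(** By continuity, an open set inside the closure of the preimage of a nowhere dense [F i] has its
    image inside [closure (F i)]; the second hypothesis, openness of [f], would give that image
    interior points. *)
Lemma meager_preimage (S T : topologicalType) (f : S -> T) (A : set T) :
  continuous f -> (forall x U, nbhs x U -> nbhs (f x) (f @` U)) ->
  meager A -> meager (f @^-1` A).
Proof.
move=> cf of_ [F nF AF]; exists (fun i => f @^-1` F i); last first.
  by move=> x /AF[i _ ?]; exists i.
move=> i; apply/nowhere_denseP => O oO Ocl.
apply/eqP; case: (eqVneq O set0) => // /set0P[x Ox].
have : (closure (F i))° (f x).
  apply: filterS (of_ x O _); last exact: open_nbhs_nbhs.
  move=> _ [y /Ocl yF <-] V /cf /yF[z [? ?]].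
  by exists (f z).
by rewrite (nF i).
Qed.

Lemma comeager_preimage (S T : topologicalType) (f : S -> T) (A : set T) :
  continuous f -> (forall x U, nbhs x U -> nbhs (f x) (f @` U)) ->
  comeager A -> comeager (f @^-1` A).
Proof. by move=> cf of_; exact: (meager_preimage (A := ~` A)). Qed.

Lemma baire_property_preimage (S T : topologicalType) (f : S -> T) (A : set T) :
  continuous f -> (forall x U, nbhs x U -> nbhs (f x) (f @` U)) ->
  baire_property A -> baire_property (f @^-1` A).
Proof.
move=> cf of_ [U oU mU]; exists (f @^-1` U); first exact: open_comp.
exact: meagerS (meager_preimage cf of_ mU).
Qed.

(** * Polish spaces *)

(** Members may be empty or repeated, so codes that decode to no pair can be sent to [set0]. *)
Definition enum_base (T : topologicalType) (B : nat -> set T) :=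
  (forall n, open (B n)) /\
  forall x U, nbhs x U -> exists n, B n x /\ B n `<=` U.

Section polish_spaces.
Context {R : realType}.

Lemma invSn_lt (e : R) : 0 < e -> exists n : nat, n.+1%:R^-1 < e.
Proof.
move=> e0; exists (Num.truncn e^-1).
by rewrite invf_plt ?posrE ?ltr0Sn //; exact: truncnS_gt.
Qed.

Lemma half_expr_le (e : R) : 0 < e -> exists n : nat, 2^-1 ^+ n <= e.
Proof.
move=> e0; have [n ne] := invSn_lt e0; exists n; apply: le_trans (ltW ne).
rewrite exprVn lef_pV2 ?posrE ?exprn_gt0 //.
by rewrite -natrX ler_nat; exact: ltn_expl.
Qed.

Lemma metric_ge0 (T : Type) (d : T -> T -> R) x y : is_metric d -> 0 <= d x y.
Proof.
move=> md; have := metric_triangular md x y x.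
rewrite (metric_refl md) (metric_symmetric md y x); lra.
Qed.

Context {T : topologicalType}.

Lemma nbhs_metric_ball (d : T -> T -> R) x (e : R) :
  compatible_metric d -> 0 < e -> nbhs x [set y | d x y < e].
Proof. by move=> [_ dn] e0; apply/dn; exists e. Qed.

Lemma closure_metric_ball (d : T -> T -> R) x (e : R) :
  compatible_metric d -> closure [set y | d x y < e] `<=` [set y | d x y <= e].
Proof.
move=> cd y yc /=; apply/ler_addgt0Pr => r r0.
have [z [/= xz yz]] := yc _ (nbhs_metric_ball y cd r0).
have := metric_triangular cd.1 x z y.
rewrite (metric_symmetric cd.1 z y); lra.
Qed.

Lemma dense_nbhs (D U : set T) (x : T) : dense D -> nbhs x U -> exists y, U y /\ D y.
Proof.
move=> dD /nbhs_interior/nbhs_singleton Ux.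
have [y [Uy Dy]] := dD _ (ex_intro _ x Ux) (open_interior U).
by exists y; split => //; exact: interior_subset.
Qed.

Lemma polish_enum_base : polish R T -> exists B : nat -> set T, enum_base B.
Proof.
move=> [[x0 _] [D cD dD] [d cd _]]; have md := cd.1.
have [z zD] : exists z : nat -> T, D `<=` range z.
  have /pfcard_geP[->|[f]] := cD; first by exists (fun=> x0).
  by exists f => x Dx; have [n _ <-] := surj (f := f) Dx; exists n.
exists (fun n => if unpickle n is Some (i, j)
  then [set y | d (z i) y < (j : nat).+1%:R^-1] else set0); split.
  move=> n; case: unpickle => [[i j]|]; last exact: open0.
  rewrite openE => y; rewrite /= -subr_gt0 => zy.
  apply: filterS (nbhs_metric_ball y cd zy) => t /= yt.
  rewrite /= ltrBrDl in yt *; apply: le_lt_trans yt; exact: metric_triangular.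
move=> x U /cd.2[e e0 eU].
have [j jlt] : exists j : nat, j.+1%:R^-1 < e / 2 by apply: invSn_lt; rewrite divr_gt0.
have j0 : 0 < j.+1%:R^-1 :> R by rewrite invr_gt0.
have [y [xy Dy]] := dense_nbhs dD (nbhs_metric_ball x cd j0).
have [i _ zi] := zD _ Dy.
exists (pickle (i, j)); rewrite pickleK zi; split => [|t] /=.
  by rewrite (metric_symmetric md).
move=> yt; apply: eU; move: jlt xy yt (metric_triangular md x y t) => /=.
by move: (_.+1%:R^-1) => r; lra.
Qed.

(** An infinite path from the root of the tree of finite sequences; non-empty cells of a scheme
    shrink to a point along it. *)
Definition branch (s : nat -> seq nat) :=
  s 0%N = [::] /\ forall k, exists n, s k.+1 = n :: s k.

(* Sequences are read backwards, so that [n :: s] extends [s]. *)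
Lemma closed_scheme (U : nat -> set T) :
  polish R T -> (forall k, open (U k)) ->
  exists K : seq nat -> set T, [/\ K [::] = setT,
    forall s x, U (size s) x -> K s x ->
      exists n, K (n :: s) x /\ (nbhs x (K s) -> nbhs x (K (n :: s)))
  & forall s, branch s -> (forall k, K (s k) !=set0) ->
      exists p, [/\ forall k, U k p, forall k, K (s k) p
        & forall N, nbhs p N -> exists k, K (s k) `<=` N]].
Proof.
move=> pT oU; have [B [oB nB]] := polish_enum_base pT.
have [_ _ [d cd dcomp]] := pT; have md := cd.1.
(* [L k n] is [closure (B n)] if that closure lies in [U k] and has diameter at most [1/(k+1)], and
   is empty otherwise. Closed cells inside [U k] keep the limit of a branch in every [U k]. *)
pose L k n := [set x | [/\ closure (B n) x, closure (B n) `<=` U k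
  & forall u v, closure (B n) u -> closure (B n) v -> d u v <= k.+1%:R^-1]].
have LU k x : U k x -> exists n, L k n x /\ nbhs x (L k n).
  move=> Ux; have /cd.2[e e0 eU] := open_nbhs_nbhs (conj (oU _) Ux).
  have : 0 < k.+1%:R^-1 :> R by rewrite invr_gt0.
  rewrite {}/L; move: (k.+1%:R^-1) => ek k0.
  (* The closed ball of radius [r] around [x] stays in the [e]-ball and has diameter at most
     [ek]. *)
  pose r := Num.min (e / 2) (ek / 2).
  have r0 : 0 < r by rewrite /r lt_min; apply/andP; split; lra.
  have re : r <= e / 2 by rewrite /r ge_min lexx.
  have rk : r <= ek / 2 by rewrite /r ge_min lexx orbT.
  have [n [Bx Br]] := nB _ _ (nbhs_metric_ball x cd r0).
  have clB y : closure (B n) y -> d x y <= r.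
    by move=> /(closureS Br)/closure_metric_ball; exact.
  have LB y : B n y -> [/\ closure (B n) y, closure (B n) `<=` U k
      & forall u v, closure (B n) u -> closure (B n) v -> d u v <= ek].
    move=> /subset_closure yB; split=> // [z /clB xz|u v /clB xu /clB xv].
      by apply: eU => /=; lra.
    have := metric_triangular md u x v.
    by rewrite (metric_symmetric md u x); lra.
  exists n; split; first exact: LB.
  by apply: filterS LB _; exact: open_nbhs_nbhs.
pose K := fix K s := if s is n :: s' then K s' `&` L (size s') n else setT.
exists K; split=> //= [s x /LU[n [Lx nLx]] Kx|s [s0 sS] Kne].
  by exists n; split => // nKx; exact: filterI.
have sizes k : size (s k) = k.
  by elim: k => [|k IH]; [rewrite s0|have [n ->] := sS k; rewrite /= IH].
have KS k : exists n, K (s k.+1) = K (s k) `&` L k n.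
  by have [n ->] := sS k; exists n; rewrite /= sizes.
have [n sn] := choice KS.
have Kle j k : (j <= k)%N -> K (s k) `<=` K (s j).
  elim: k => [|k IH]; first by rewrite leqn0 => /eqP ->.
  rewrite leq_eqVlt => /orP[/eqP->//|/IH]; rewrite sn.
  by apply: subset_trans => x [].
have KL k : K (s k.+1) `<=` L k (n k) by rewrite sn => x [].
have [z zK] := choice Kne.
have [p zp] : exists p : T, z @ \oo --> p.
  apply: dcomp => e /invSn_lt[k ke]; exists k.+1 => i j ki kj.
  have [zi _ h] := KL k _ (Kle _ _ ki _ (zK i)).
  have [zj _ _] := KL k _ (Kle _ _ kj _ (zK j)).
  exact: le_lt_trans (h _ _ zi zj) ke.
have clp k : closure (B (n k)) p.
  have ev : \forall j \near \oo, closure (B (n k)) (z j).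
    exists k.+1 => // j /= kj.
    by have [] := KL k _ (Kle _ _ kj _ (zK j)).
  exact: closed_cvg _ (@closed_closure _ _) ev _ zp.
have Lp k : L k (n k) p.
  by have [_ h1 h2] := KL k _ (zK k.+1); split.
exists p; split=> [k|k|N /cd.2[e /invSn_lt[k ke] eN]].
- by have [h1 h2 _] := Lp k; exact: h2.
- by elim: k => [|k IH]; [rewrite s0|rewrite sn; split].
- exists k.+1 => x /KL[xc _ h]; apply: eN => /=.
  exact: le_lt_trans (h _ _ (clp k) xc) ke.
Qed.

(** A branch of a closed scheme for the sets [O] minus [closure (F k)] has a limit that lies in [O]
    and in no [F k]. *)
Theorem baire_category (O : set T) :
  polish R T -> open O -> O !=set0 -> ~ meager O.
Proof.
move=> pT oO [x Ox] [F nF OF].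
have [|K [K0 KS Klim]] := closed_scheme (U := fun k => O `\` closure (F k)) pT.
  by move=> k; apply: openI => //; exact/closed_openC/closed_closure.
(* The cell stays a neighbourhood of the current point, so its interior meets [O] in a non-empty
   open set that the next nowhere dense set cannot fill. *)
pose good (t : seq nat * T) := nbhs t.2 (K t.1) /\ O t.2.
have step t : good t -> exists t', good t' /\ exists n, t'.1 = n :: t.1.
  case: t => s y [/= /nbhs_interior Ky Oy].
  have [z [[Kz Oz] Fz]] : exists z, ((K s)° `&` O) z /\ ~ closure (F (size s)) z.
    apply: contrapT => /forallNP h; have /nowhere_denseP nFs := nF (size s).
    have := nFs ((K s)° `&` O) (openI (open_interior _) oO).
    rewrite -subset0 => h'; apply: (h' _ y).
      by move=> z zO; apply: contrapT => zF; apply: (h z).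
    by split => //; exact: nbhs_singleton.
  have [n [Kn]] := KS s z (conj Oz Fz) (interior_subset Kz).
  by move=> /(_ Kz) nK; exists (n :: s, z); split => //; exists n.
have g0 : good ([::], x) by split => //=; rewrite K0; exact: filterT.
have /choice[f fP] (t : {t | good t}) :
    exists t' : {t | good t}, exists n, (sval t').1 = n :: (sval t).1.
  by case: t => t gt; have [t' [gt' h]] := step t gt; exists (exist _ t' gt').
pose s k := (sval (iter k f (exist _ _ g0))).1.
have [k|p [Up _ _]] := Klim s (conj erefl (fun k => fP _)).
  case: (svalP (iter k f (exist _ _ g0))) => /nbhs_singleton Kz _.
  by exists (sval (iter k f (exist _ _ g0))).2.
by have [i _ Fp] := OF p (Up 0%N).1; apply: (Up i).2; exact: subset_closure.
Qed.

Lemma comeager_meets (A N : set T) (x : T) :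
  polish R T -> comeager A -> nbhs x N -> exists y, N y /\ A y.
Proof.
move=> pT cA; rewrite nbhsE => -[O [oO Ox] ON]; apply: contrapT => /forallNP h.
apply: (baire_category pT oO); first by exists x.
by apply: meagerS cA => y /ON Ny Ay; apply: (h y).
Qed.

End polish_spaces.

(** * Measurable selection *)

Section selection.
Context {T : topologicalType} (B : nat -> set T) (baseB : enum_base B).

(** The envelope is [A] itself where [A] is locally meager, that is on [U], and everything
    elsewhere. If [C] avoids [A] and equals an open [O] up to a meager set, then [A] is meager in
    every basic subset of [O], so [O] lies in [U], where the envelope adds nothing to [A]; hence [C]
    misses [O] and is meager. *)
Lemma baire_envelope (A : set T) : exists E, [/\ baire_property E, A `<=` E
  & forall C, baire_property C -> C `<=` E `\` A -> meager C].
Proof.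
have [oB nB] := baseB; pose U := \bigcup_(n in [set n | meager (A `&` B n)]) B n.
have oU : open U by apply: bigcup_open => n _; exact: oB.
have mAU : meager (A `&` U).
  pose F n := if pselect (meager (A `&` B n)) then A `&` B n else set0.
  apply: (@meagerS _ _ (\bigcup_n F n)) => [x [Ax [n /= mn Bx]]|].
    by exists n => //; rewrite /F; case: pselect.
  apply: meager_bigcup => n; rewrite /F; case: pselect => [|h] //=; exact: meager0.
exists (~` U `|` (A `&` U)); split.
- by apply: baire_propertyU; [apply/baire_propertyC/open_baire_property|
    exact: meager_baire_property].
- by move=> x Ax; have [Ux|nU] := pselect (U x); [right|left].
move=> C [O oO mO] CA; apply: (meagerS _ mO) => x Cx; left; split => // Ox.
have [n [Bx BO]] := nB x O (open_nbhs_nbhs (conj oO Ox)).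
have [[nU|[Ax _]] nA] := CA x Cx; last by [].
apply: nU; exists n => //=; apply: (@meagerS _ _ (C `+` O)) => //.
by move=> y [Ay /BO Oy]; right; split => // /CA[].
Qed.

Context {Z : topologicalType} (z0 : Z).

(* Lusin-Sierpinski together with Jankov-von Neumann: the Souslin operation
   preserves the Baire property because the envelopes [V s] of the sets
   [{t | exists z, K s z /\ R t z}] satisfy [V s = \bigcup_n V (n :: s)] off a
   meager set, and following leftmost branches gives a measurable selector. *)
Lemma baire_selection (K : seq nat -> set Z) (E : seq nat -> set T)
    (R : T -> Z -> Prop) :
  (forall t z, R t z -> K [::] z) ->
  (forall s t z, R t z -> K s z -> exists n, K (n :: s) z) ->
  (forall s t z, R t z -> K s z -> E s t) ->
  (forall s, baire_property (E s)) ->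
  (forall t s, branch s -> (forall k, E (s k) t) ->
    exists p, [/\ R t p, forall k, K (s k) p
      & forall N, nbhs p N -> exists k, K (s k) `<=` N]) ->
  exists g : T -> Z, [/\ baire_measurable g,
    baire_property [set t | exists z, R t z]
  & comeager [set t | (exists z, R t z) -> R t (g t)]].
Proof.
move=> K0 KS KE bE lim.
pose A s := [set t | exists z, K s z /\ R t z].
(* Cutting the envelope with [E s] makes branches through the [V s] satisfy the limit hypothesis. *)
have /choice[V hV] s : exists V, [/\ baire_property V, A s `<=` V, V `<=` E s
    & forall C, baire_property C -> C `<=` V `\` A s -> meager C].
  have [V [bV AV mV]] := baire_envelope (A s); exists (V `&` E s); split.
  - exact: baire_propertyI.
  - by move=> t At; split; [exact: AV|have [z [Kz Rz]] := At; exact: KE Kz].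
  - by move=> t [].
  - by move=> C bC CV; apply: mV => // t /CV[[]].
pose M := \bigcup_s (V s `\` \bigcup_n V (n :: s)).
have mM : meager M.
  apply: meager_bigcup => s; have [bV AV VE mV] := hV s; apply: mV.
    apply: baire_propertyD => //; apply: baire_property_bigcup => n.
    by have [] := hV (n :: s).
  move=> t [Vt nV]; split => // -[z [Kz Rz]]; apply: nV.
  have [n Kn] := KS s t z Rz Kz; exists n => //.
  by have [_ AVn _ _] := hV (n :: s); apply: AVn; exists z.
(* [L s] collects the points whose leftmost path through the sets [V] passes through [s]; for
   sequences of equal length these sets are disjoint. *)
pose L := fix L s := if s is n :: s' then
  L s' `&` (V s `\` \bigcup_(m in [set m | (m < n)%N]) V (m :: s')) else setT.
have bL s : baire_property (L s).
  elim: s => [|n s IH] /=; first exact/open_baire_property/openT.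
  apply: baire_propertyI => //; apply: baire_propertyD.
    by have [] := hV (n :: s).
  rewrite bigcup_mkcond; apply: baire_property_bigcup => m.
  case: ifP => _; first by have [] := hV (m :: s).
  exact/open_baire_property/open0.
have L_uniq s s' t : size s = size s' -> L s t -> L s' t -> s = s'.
  elim: s s' => [|n s IH] [|n' s'] //= [ss] [Ls [Vn nV]] [Ls' [Vn' nV']].
  have E' := IH _ ss Ls Ls'; rewrite -{}E' in Vn' nV' *; congr cons.
  case: (ltngtP n n') => // h; exfalso; first by apply: nV'; exists n.
  by apply: nV; exists n'.
have /choice[b bP] t : exists b : nat -> seq nat, V [::] t -> ~ M t ->
    branch b /\ forall k, V (b k) t /\ L (b k) t.
  have [[V0 nM]|h] := pselect (V [::] t /\ ~ M t); last first.
    by exists (fun=> [::]) => V0 nM; case: h.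
  have step (s : seq nat) : exists s', V s t /\ L s t ->
      (V s' t /\ L s' t) /\ exists n, s' = n :: s.
    have [[Vs Ls]|?] := pselect (V s t /\ L s t); last by exists s.
    have ex : exists n, `[< V (n :: s) t >].
      apply: contrapT => h; apply: nM; exists s => //; split => // -[n _ Vn].
      by apply: h; exists n; apply/asboolP.
    exists (ex_minn ex :: s) => _; case: ex_minnP => n /asboolP Vn nmin.
    split; last by exists n.
    split => //; split => //; split => // -[m /= mn Vm].
    by move: mn; rewrite ltnNge nmin //; apply/asboolP.
  have [f fP] := choice step.
  have VL k : V (iter k f [::]) t /\ L (iter k f [::]) t.
    by elim: k => [//|k IH]; have [] := fP _ IH.
  exists (fun k => iter k f [::]) => _ _; split => //; split => // k.
  by have [] := fP _ (VL k).
have /choice[g gP] t : exists p : Z, (V [::] t -> ~ M t ->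
    [/\ R t p, forall k, K (b t k) p
      & forall N, nbhs p N -> exists k, K (b t k) `<=` N]) /\
    (~ V [::] t -> p = z0).
  have [V0|nV0] := pselect (V [::] t); last by exists z0.
  have [Mt|nM] := pselect (M t); first by exists z0.
  have [bt VL] := bP t V0 nM.
  have [k|p pP] := lim t (b t) bt; last by exists p.
  by have [_ _ VE _] := hV (b t k); apply/VE/(VL k).1.
have RV t z : R t z -> V [::] t.
  by move=> Rz; have [_ AV _ _] := hV [::]; apply: AV; exists z; split => //; exact: K0 Rz.
have b0 : baire_property (V [::]) by have [] := hV [::].
exists g; split.
(* Some cell on the leftmost branch of [t] lies inside any given neighbourhood of [g t]. So off [M]
   and inside [V [::]], the value is in [U] exactly when [t] is in some [L s] with [K s] inside [U];
   outside [V [::]] it is the default [z0]. *)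
- move=> U oU; pose W := \bigcup_s (if `[< K s `<=` U >] then L s else set0).
  have bW : baire_property W.
    apply: baire_property_bigcup => s; case: ifP => _ //.
    exact/open_baire_property/open0.
  apply: (baire_property_ae (B := (V [::] `&` W) `|`
      (if `[< U z0 >] then ~` V [::] else set0)) mM) => [t nM|]; last first.
    apply: baire_propertyU; first exact: baire_propertyI.
    case: ifP => _; first exact: baire_propertyC.
    exact/open_baire_property/open0.
  have [V0|nV0] := pselect (V [::] t); last first.
    rewrite /= ((gP t).2 nV0); split=> [Uz|[[]//|]].
      by right; case: asboolP.
    by case: asboolP.
  have [bt VL] := bP t V0 nM; have [Rg Kg Ng] := (gP t).1 V0 nM.
  split=> [/= Ug|[[_ [s _]]|]]; last by case: asboolP => // _ /(_ V0).
    left; split => //; have [k kU] := Ng U (open_nbhs_nbhs (conj oU Ug)).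
    by exists (b t k) => //; case: asboolP => // _; exact: (VL k).2.
  case: asboolP => // sU Ls; apply: sU.
  suff -> : s = b t (size s) by [].
  apply: (L_uniq _ _ t) => //; last exact: (VL _).2.
  by elim: (size s) => [|k IH]; [rewrite bt.1|have [n ->] := bt.2 k; rewrite /= -IH].
- apply: (baire_property_ae (B := V [::]) mM) => // t nM; split=> [[z /RV]//|V0].
  by have [Rg _ _] := (gP t).1 V0 nM; exists (g t).
- apply: meagerS mM => t; apply: contra_notP => nM -[z /RV V0].
  by have [] := (gP t).1 V0 nM.
Qed.

End selection.

(** * Category in products and generic continuity *)

Section products.
Context {S T : topologicalType}.

Lemma nbhs_prodP (p : S * T) (U : set (S * T)) :
  nbhs p U <-> exists A B, [/\ nbhs p.1 A, nbhs p.2 B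
    & forall x y, A x -> B y -> U (x, y)].
Proof.
split=> [[[A B] [/= nA nB] AB]|[A [B [nA nB AB]]]].
  by exists A, B; split=> // x y Ax By; exact: AB.
by exists (A, B) => //= -[x y] [/= Ax By]; exact: AB.
Qed.

Lemma enum_base_prod (B : nat -> set S) (B' : nat -> set T) :
  enum_base B -> enum_base B' ->
  exists C : nat -> set (S * T), enum_base C.
Proof.
move=> [oB nB] [oB' nB'].
exists (fun n => if unpickle n is Some (i, j) then B i `*` B' j else set0); split.
  move=> n; case: unpickle => [[i j]|]; last exact: open0.
  rewrite openE => -[x y] [/= Bx By]; apply/nbhs_prodP.
  by exists (B i), (B' j); split => //; exact: open_nbhs_nbhs.
move=> [x y] U /nbhs_prodP[V [W [/= nV nW VW]]].
have [i [Bx BV]] := nB x V nV; have [j [By BW]] := nB' y W nW.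
exists (pickle (i, j)); rewrite pickleK; split => // -[u v] [/= /BV Vu /BW Wv].
exact: VW.
Qed.

Lemma snd_continuous : continuous (@snd S T).
Proof.
by move=> p U nU; apply/nbhs_prodP; exists setT, U; split=> //; exact: filterT.
Qed.

Lemma snd_image_nbhs (p : S * T) U : nbhs p U -> nbhs p.2 (@snd S T @` U).
Proof.
move=> /nbhs_prodP[V [W [nV nW VW]]]; apply: filterS nW => y Wy.
by exists (p.1, y) => //; apply: VW => //; exact: nbhs_singleton nV.
Qed.

(** For a closed nowhere dense set and a basic open set [B n], the [y] whose section does not cover
    [B n] form an open dense set; for [y] in all of these, the complements of the sections are open
    dense. *)
Lemma kuratowski_ulam (B : nat -> set S) (A : set (S * T)) :
  enum_base B -> comeager A ->
  comeager [set y | comeager [set x | A (x, y)]].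
Proof.
move=> [oB nB] [F nF AF].
have oF i : open (~` closure (F i)) by exact/closed_openC/closed_closure.
(* The premise makes the condition void for empty members of the base. *)
pose P (k : nat * nat) :=
  [set y | B k.2 !=set0 -> exists x, B k.2 x /\ ~ closure (F k.1) (x, y)].
apply: (@comeagerS _ (\bigcap_k P k)) => [y Py|].
  apply: (@comeagerS _ (\bigcap_i [set x | ~ closure (F i) (x, y)])) => [x xF /=|].
    apply: contrapT => /AF[i _ Fx]; apply: (xF i) => //; exact: subset_closure.
  apply: comeager_bigcap => i; apply: comeager_open_dense => [|U oU [x Ux]].
    rewrite openE => x /= nx.
    have := open_nbhs_nbhs (conj (oF i) nx).
    move=> /nbhs_prodP[V [W [nV nW VW]]]; apply: filterS nV => u Vu.
    by apply: VW => //; exact: nbhs_singleton nW.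
  have [n [Bx BU]] := nB _ _ (open_nbhs_nbhs (conj oU Ux)).
  have [|u [Bu uF]] := Py (i, n) Logic.I; first by exists x.
  by exists u; split => //; exact: BU.
apply: comeager_bigcap => -[i n]; apply: comeager_open_dense => [|U oU [y Uy]].
  have [[x0 Bx0]|nB0] := pselect (B n !=set0); last first.
    by rewrite (_ : P _ = setT); [exact: openT|apply/seteqP; split=> // ? _ /nB0].
  rewrite openE => y [|/= x [Bx xF]]; first by exists x0.
  have := open_nbhs_nbhs (conj (oF i) xF).
  move=> /nbhs_prodP[V [W [nV nW VW]]]; apply: filterS nW => v Wv _.
  by exists x; split => //; apply: VW => //; exact: nbhs_singleton nV.
have [[x0 Bx0]|nB0] := pselect (B n !=set0); last by exists y; split => // /nB0.
apply: contrapT => h; have /nowhere_denseP nFi := nF i.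
suff BU0 : B n `*` U = set0 by have : (B n `*` U) (x0, y) by []; rewrite BU0.
apply: nFi => [|[u v] [/= Bu Uv]].
  rewrite openE => -[u v] [/= Bu Uv]; apply/nbhs_prodP; exists (B n), U.
  by split=> //; exact: open_nbhs_nbhs.
apply: contrapT => nuv; apply: h; exists v; split => // _.
by exists u.
Qed.

End products.

Definition continuous_rel (S T : topologicalType) (C : set S) (f : S -> T) :=
  forall x, C x -> forall U, nbhs (f x) U ->
    exists2 O, nbhs x O & forall y, O y -> C y -> U (f y).

Lemma continuous_relS (S T : topologicalType) (C D : set S) (f : S -> T) :
  D `<=` C -> continuous_rel C f -> continuous_rel D f.
Proof.
move=> DC cf x /DC Cx U /(cf x Cx)[O nO OU]; exists O => // y Oy /DC.
exact: OU.
Qed.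

(** Discard, for each basic open set, the meager set on which its preimage differs from an open
    set. *)
Lemma baire_measurable_continuous (S T : topologicalType) (B : nat -> set T)
    (f : S -> T) :
  enum_base B -> baire_measurable f ->
  exists2 C : set S, comeager C & continuous_rel C f.
Proof.
move=> [oB nB] bf; have /choice[O hO] n : exists O : set S,
    open O /\ meager (f @^-1` B n `+` O).
  by have [O ? ?] := bf _ (oB n); exists O.
exists (\bigcap_n ~` (f @^-1` B n `+` O n)).
  by apply: comeager_bigcap => n; rewrite /comeager setCK; exact: (hO n).2.
have CO x n : (\bigcap_n ~` (f @^-1` B n `+` O n)) x -> B n (f x) <-> O n x.
  move=> /(_ n Logic.I)/not_orP[h1 h2]; split=> h; apply: contrapT => h'.
    exact: h1.
  exact: h2.
move=> x Cx U /nB[n [Bx BU]]; exists (O n).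
  by apply: open_nbhs_nbhs; split; [exact: (hO n).1|exact/CO].
by move=> y Oy Cy; apply: BU; exact/CO.
Qed.

(** Provides the open sets that [closed_scheme] takes as input. *)
Lemma comeager_Gdelta (T : topologicalType) (C : set T) : comeager C ->
  exists U : nat -> set T, [/\ forall k, open (U k), comeager (\bigcap_k U k)
    & \bigcap_k U k `<=` C].
Proof.
move=> [F nF CF]; exists (fun k => ~` closure (F k)); split.
- by move=> k; exact/closed_openC/closed_closure.
- apply: comeager_bigcap => k; rewrite /comeager setCK.
  exists (fun=> closure (F k)); last by move=> x ?; exists 0%N.
  move=> _; rewrite /nowhere_dense (_ : closure _ = closure (F k)).
    exact: nF.
  exact: esym ((closure_id _).1 (@closed_closure _ _)).
- move=> x xU; apply: contrapT => /CF[k _ Fx]; apply: (xU k) => //.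
  exact: subset_closure.
Qed.

(** * Topological groups *)

Section frink.
Context {R : realType} {T : Type} (rho : T -> T -> R).
Hypothesis rho_ge0 : forall x y, 0 <= rho x y.
Hypothesis rho_refl : forall x, rho x x = 0.
Hypothesis rho_sep : forall x y, rho x y = 0 -> x = y.
Hypothesis rho_sym : forall x y, rho x y = rho y x.
Hypothesis rho_quasi : forall x y z w e,
  rho x y <= e -> rho y z <= e -> rho z w <= e -> rho x w <= 2 * e.

Fixpoint chain_len (x : T) (s : seq T) : R :=
  if s is y :: s' then rho x y + chain_len y s' else 0.

Let chain_len_ge0 x s : 0 <= chain_len x s.
Proof. by elim: s x => //= y s IH x; rewrite addr_ge0. Qed.

Let chain_len_cat x s t :
  chain_len x (s ++ t) = chain_len x s + chain_len (last x s) t.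
Proof. by elim: s x => [|y s IH] x /=; rewrite ?add0r // IH addrA. Qed.

(** [y] is the first point at which the running length reaches [c]. *)
Let chain_split x s c : (0 < size s)%N -> 0 <= c -> c <= chain_len x s ->
  exists s1 y s2, [/\ s = s1 ++ y :: s2, chain_len x s1 <= c
    & chain_len y s2 <= chain_len x s - c].
Proof.
elim: s x c => // y s IH x c _ c0 /= cs.
have [h|h] := leP c (rho x y).
  by exists [::], y, s; split => //=; lra.
case: s IH cs => [|z s] IH cs.
  by exists [::], y, [::]; split => //=; move: cs => /=; lra.
have [||s1 [w [s2 [-> h1 h2]]]] := IH y (c - rho x y) isT; [lra|lra|].
by exists (y :: s1), w, s2; split => //=; lra.
Qed.

(* Cut the chain where half of its length is used up: the two remaining
   pieces and the link between them have [rho] at most the full length. *)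
Lemma frink_inequality x s : rho x (last x s) <= 2 * chain_len x s.
Proof.
have [n] := ubnP (size s); elim: n x s => // n IH x s sn.
have [/size0nil->|s0] := posnP (size s); first by rewrite /= rho_refl mulr0.
set c := chain_len x s; have c0 : 0 <= c by exact: chain_len_ge0.
have [||s1 [y [s2 [es h1 h2]]]] := @chain_split x s (c / 2) s0; [lra|rewrite -/c; lra|].
have : size s = (size s1 + (size s2).+1)%N by rewrite es size_cat.
move: sn; rewrite ltnS => sn ss.
have i1 := IH x s1 (leq_trans _ sn); have i2 := IH y s2 (leq_trans _ sn).
rewrite es last_cat /=; apply: (rho_quasi (y := last x s1) (z := y)).
- by apply: le_trans (i1 _) _; [rewrite ss addnS ltnS leq_addr|lra].
- rewrite /c es chain_len_cat /=.
  have := chain_len_ge0 x s1; have := chain_len_ge0 y s2; lra.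
- apply: le_trans (i2 _) _; first by rewrite ss addnS ltnS leq_addl.
  rewrite -/c in h2; lra.
Qed.

Let chain_rev x s : exists t, last (last x s) t = x /\
  chain_len (last x s) t = chain_len x s.
Proof.
elim: s x => [|y s IH] x /=; first by exists [::].
have [t [lt ct]] := IH y; exists (rcons t x); rewrite last_rcons; split => //.
by rewrite -cats1 chain_len_cat lt ct /= addr0 addrC rho_sym.
Qed.

(** [d] is the infimum of chain lengths: concatenation gives the triangle inequality, reversal gives
    symmetry, and Frink's inequality gives the lower bound. A map preserving [rho] preserves chain
    lengths; applied to right translations, this yields an invariant metric. *)
Lemma frink_metric : exists d : T -> T -> R, [/\ is_metric d,
    forall x y, d x y <= rho x y, forall x y, rho x y <= 2 * d x y
  & forall f : T -> T, (forall x y, rho (f x) (f y) = rho x y) ->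
      forall x y, d (f x) (f y) <= d x y].
Proof.
pose C x y := [set r | exists2 s, last x s = y & r = chain_len x s].
pose d x y := inf (C x y).
have lC x y : has_lbound (C x y) by exists 0 => _ [s _ ->]; exact: chain_len_ge0.
have nC x y : C x y !=set0 by exists (rho x y + 0), [:: y].
have dle x s : d x (last x s) <= chain_len x s.
  by apply: ge_inf => //; exists s.
have dge x y (e : R) : (forall s, last x s = y -> e <= chain_len x s) -> e <= d x y.
  by move=> h; apply: lb_le_inf => // _ [s /h ? ->].
have d_rho x y : d x y <= rho x y by have := dle x [:: y]; rewrite /= addr0.
have rho_d x y : rho x y <= 2 * d x y.
  suff : rho x y / 2 <= d x y by lra.
  by apply: (dge _ _) => s <-; have := frink_inequality x s; lra.
have dsym x y : d x y <= d y x.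
  by apply: (dge _ _) => s <-; have [t [lt <-]] := chain_rev y s; rewrite -{2}lt.
exists d; split => //; first split.
- move=> x; apply/eqP; rewrite eq_le (le_trans (d_rho x x)) ?rho_refl //=.
  by apply: (dge _ _) => s _; exact: chain_len_ge0.
- move=> x y dxy; apply: rho_sep; apply/eqP; rewrite eq_le rho_ge0 andbT.
  by have := rho_d x y; rewrite dxy mulr0.
- by move=> x y; apply/eqP; rewrite eq_le !dsym.
- move=> x y z; rewrite -lerBlDr; apply: (dge _ _) => s sy; rewrite lerBlDr -lerBlDl.
  apply: (dge _ _) => t tz; rewrite lerBlDl -sy -chain_len_cat.
  by have := dle x (s ++ t); rewrite last_cat sy tz.
- move=> f fP x y; apply: (dge _ _) => s <-.
  have -> : chain_len x s = chain_len (f x) (map f s).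
    by elim: s x => //= z s IH x; rewrite fP IH.
  by rewrite -last_map; exact: dle.
Qed.

End frink.

Lemma continuous_slices (S T U : topologicalType) (f : S * T -> U) :
  continuous f -> (forall x, continuous (fun y => f (x, y)))
    /\ (forall y, continuous (fun x => f (x, y))).
Proof.
move=> cf; split=> [x y|y x] V /cf/nbhs_prodP[A [B [/= nA nB AB]]].
  by apply: filterS nB => z Bz; apply: AB => //; exact: nbhs_singleton nA.
by apply: filterS nA => z Az; apply: AB => //; exact: nbhs_singleton nB.
Qed.

Section topological_groups.
Context {G : topologicalGroupType}.
Implicit Types g h : G.

Lemma mulgl_continuous g : continuous (fun h => g * h)%g.
Proof. exact: (continuous_slices (@mulg_continuous G)).1. Qed.

Lemma mulgr_continuous g : continuous (fun h => h * g)%g.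
Proof. exact: (continuous_slices (@mulg_continuous G)).2. Qed.

Lemma mulgr_open g h (U : set G) :
  nbhs h U -> nbhs (h * g)%g ((fun k => k * g)%g @` U).
Proof.
move=> nU; have nP : nbhs (h * g)%g [set k | U (k * g^-1)%g].
  by apply: (@mulgr_continuous g^-1%g); rewrite mulgK.
apply: filterS nP => k Uk.
by exists (k * g^-1)%g => //; rewrite mulgVK.
Qed.

Lemma nbhs1_mulgV (V : set G) : nbhs (1%g : G) V ->
  exists2 W, nbhs (1%g : G) W & forall g h, W g -> W h -> V (g * h^-1)%g.
Proof.
move=> nV; have /nbhs_prodP[A [B [/= nA nB AB]]] :
    nbhs (1%g : G, 1%g : G) [set p | V (p.1 * p.2)%g].
  by apply: mulg_continuous; rewrite /= mulg1.
exists (A `&` (fun g => g^-1)%g @^-1` B).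
  by apply: filterI => //; apply: invg_continuous; rewrite /= invg1.
by move=> g h [Ag _] [_ Bh]; exact: AB Ag Bh.
Qed.

Lemma nbhs1_mulg (V : set G) : nbhs (1%g : G) V ->
  exists W, [/\ nbhs (1%g : G) W, forall g, W g -> W g^-1%g
    & forall g h, W g -> W h -> V (g * h)%g].
Proof.
move=> /nbhs1_mulgV[W nW WV]; exists (W `&` (fun g => g^-1)%g @^-1` W); split.
- by apply: filterI => //; apply: invg_continuous; rewrite /= invg1.
- by move=> g [Wg Wg']; split => //=; rewrite invgK.
- by move=> g h [Wg _] [_ Wh]; have := WV _ _ Wg Wh; rewrite invgK.
Qed.

Lemma nbhs_divr g (V : set G) : nbhs (1%g : G) V ->
  nbhs g [set h | V (h * g^-1)%g].
Proof. by move=> nV; apply: (@mulgr_continuous g^-1%g); rewrite mulgV. Qed.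

Lemma nbhs1_conj g (V : set G) : nbhs (1%g : G) V ->
  nbhs (1%g : G) [set h | V (g * h * g^-1)%g].
Proof.
move=> /(nbhs_divr g) nV.
have {}nV : nbhs (g * 1)%g [set h | V (h * g^-1)%g] by rewrite mulg1.
exact: (mulgl_continuous nV).
Qed.

Lemma nbhs_divr1 g (U : set G) : nbhs g U ->
  nbhs (1%g : G) [set h | U (h * g)%g].
Proof. by move=> nU; apply: (@mulgr_continuous g); rewrite mul1g. Qed.

Lemma nbhs_divl g (V : set G) : nbhs (1%g : G) V ->
  nbhs g [set h | V (g * h^-1)%g].
Proof.
move=> nV; have {}nV : nbhs (g * g^-1)%g V by rewrite mulgV.
have nV' : nbhs g^-1%g [set h | V (g * h)%g] := mulgl_continuous nV.
exact: (@invg_continuous G g _ nV').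
Qed.

Context {R : realType}.

(* Birkhoff-Kakutani: [N g] is the largest [2^-n] with [g] outside [V n], and
   [V n.+1 * V n.+1 * V n.+1 `<=` V n] makes [N (g * h^-1)] satisfy the
   hypotheses of Frink's inequality. *)
Lemma right_invariant_metric : polish R G ->
  exists2 d : G -> G -> R, compatible_metric d
    & forall g h k, d (g * k)%g (h * k)%g = d g h.
Proof.
move=> [_ _ [del cdel _]].
(* [next] shrinks a neighbourhood to a symmetric one whose triple products stay inside it; the bound
   on [del] makes the [V n] below a base at [1]. *)
have /choice[next nextP] (p : nat * set G) : exists W, nbhs (1%g : G) p.2 ->
    [/\ nbhs (1%g : G) W, forall g, W g -> W g^-1%g,
      forall g h k, W g -> W h -> W k -> p.2 (g * h * k)%g
    & forall g, W g -> del 1%g g < p.1.+1%:R^-1].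
  case: p => n V /=; have [nV|?] := pselect (nbhs (1%g : G) V); last first.
    by exists setT.
  have [W [nW _ WV]] := nbhs1_mulg nV.
  have nD : nbhs (1%g : G) [set g | del 1%g g < n.+1%:R^-1].
    by apply: nbhs_metric_ball; rewrite ?invr_gt0.
  have nWD : nbhs (1%g : G) (W `&` [set g | del 1%g g < n.+1%:R^-1]).
    exact: filterI.
  have [W' [nW' sW' WW']] := nbhs1_mulg nWD.
  exists W'; split=> // [g h k gW hW kW|g gW].
    apply: WV; first by have [] := WW' _ _ gW hW.
    by have [] := WW' _ _ kW (nbhs_singleton nW'); rewrite mulg1.
  by have [_] := WW' _ _ gW (nbhs_singleton nW'); rewrite mulg1.
pose V := fix V n := if n is m.+1 then next (m, V m) else setT.
have nV n : nbhs (1%g : G) (V n).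
  by elim: n => [|n IH]; [exact: filterT|have [] := nextP (n, V n) IH].
have V1 n : V n 1%g by exact: nbhs_singleton.
have VI n g : V n g -> V n g^-1%g.
  by case: n => // n Vg; have [_ h _ _] := nextP (n, V n) (nV n); exact: h.
have V3 n g h k : V n.+1 g -> V n.+1 h -> V n.+1 k -> V n (g * h * k)%g.
  by move=> *; have [_ _ H _] := nextP (n, V n) (nV n); exact: H.
have Vdel n g : V n.+1 g -> del 1%g g < n.+1%:R^-1.
  by move=> *; have [_ _ _ H] := nextP (n, V n) (nV n); exact: H.
have Vle m n : (m <= n)%N -> V n `<=` V m.
  elim: n => [|n IH]; first by rewrite leqn0 => /eqP ->.
  rewrite leq_eqVlt => /orP[/eqP->//|/IH h] g Vg; apply: h.
  by rewrite -(mulg1 g) -(mulg1 (g * 1)%g); exact: V3.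
(* The element [0] keeps the set non-empty for [g = 1], which lies in every [V n]. *)
pose D g := [set r : R | r = 0 \/ exists2 n, ~ V n g & r = 2^-1 ^+ n].
have p0 n : 0 < 2^-1 ^+ n :> R by rewrite exprn_gt0 // invr_gt0.
have D0 g : D g !=set0 by exists 0; left.
have Dub g : has_ubound (D g).
  exists 1 => _ [->//|[n _ ->]].
  by rewrite exprn_ile1 ?invr_ge0 // invf_le1 // ler1n.
pose N g := sup (D g).
have N_ge g n : ~ V n g -> 2^-1 ^+ n <= N g.
  by move=> Vg; apply: ub_le_sup => //; right; exists n.
have N_le g e : 0 <= e -> (forall n, ~ V n g -> 2^-1 ^+ n <= e) -> N g <= e.
  by move=> e0 h; apply: ge_sup => // _ [->//|[n /h ? ->]].
have N_lt g n : N g < 2^-1 ^+ n -> V n g.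
  by move=> h; apply: contrapT => /N_ge; rewrite leNgt h.
have N_ge0 g : 0 <= N g by apply: ub_le_sup => //; left.
have N1 : N 1%g = 0.
  by apply/eqP; rewrite eq_le N_ge0 andbT; apply: N_le => // n; case.
have NV g : N g^-1%g = N g.
  by congr sup; apply/seteqP; split => r [->|[n Vn ->]]; try (by left); right;
    exists n => // /VI; rewrite ?invgK.
have NM g h k e : N g <= e -> N h <= e -> N k <= e -> N (g * h * k)%g <= 2 * e.
  move=> gE hE kE; have e0 : 0 <= e by exact: le_trans gE.
  apply: N_le => [|n nV3]; first lra.
  rewrite leNgt; apply/negP => en; apply: nV3; have en' : e < 2^-1 ^+ n.+1.
    rewrite exprS; lra.
  by apply: V3; apply: N_lt; apply: le_lt_trans en'.
have N0 g : N g = 0 -> g = 1%g.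
  move=> g0; apply/esym/(metric_separated cdel.1)/eqP.
  rewrite eq_le metric_ge0 ?andbT; last exact: cdel.1.
  rewrite leNgt; apply/negP => /invSn_lt[n].
  by rewrite ltNge (ltW (Vdel _ _ _)) //; apply: N_lt; rewrite g0.
have N_refl g : N (g * g^-1)%g = 0 by rewrite mulgV.
have N_sep g h : N (g * h^-1)%g = 0 -> g = h by move/N0/divg1_eq.
have N_sym g h : N (g * h^-1)%g = N (h * g^-1)%g by rewrite -NV invgF.
have N_quasi g h k l e : N (g * h^-1)%g <= e -> N (h * k^-1)%g <= e ->
    N (k * l^-1)%g <= e -> N (g * l^-1)%g <= 2 * e.
  by move=> a b c; have := NM _ _ _ _ a b c; rewrite !divgKA.
have [d [md d_le d_ge d_f]] :=
  frink_metric (fun g h => N_ge0 (g * h^-1)%g) N_refl N_sep N_sym N_quasi.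
have d_r g h k : d (g * k)%g (h * k)%g <= d g h.
  by apply: (d_f (fun g => g * k)%g) => x y; rewrite mulgKA.
exists d; last first.
  move=> g h k; apply/eqP; rewrite eq_le d_r /=.
  by have := d_r (g * k)%g (h * k)%g k^-1%g; rewrite !mulgK.
have V_base (U : set G) : nbhs (1%g : G) U -> exists n, V n `<=` U.
  move=> /cdel.2[e /invSn_lt[n ne] eU]; exists n.+1 => g /Vdel gn.
  by apply: eU; exact: lt_trans ne.
split=> // g A; split=> [nA|[e e0 eA]].
  have /V_base[n nV'] := nbhs_divr1 nA.
  exists (2^-1 ^+ n.+1) => // h /= gh.
  suff /nV' : V n (h * g^-1)%g by rewrite /= mulgVK.
  rewrite -invgF; apply/VI/N_lt; have := d_ge g h; rewrite exprS in gh; lra.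
have [n ne] := half_expr_le e0.
apply: filterS (nbhs_divl g (nV n.+1)) => h /= Vgh; apply: eA => /=.
apply: le_lt_trans (d_le g h) _.
apply: (@le_lt_trans _ _ (2^-1 ^+ n.+1)); last first.
  by rewrite exprS; have := p0 n; lra.
apply: N_le => [|m nVm]; first exact: ltW (p0 n.+1).
rewrite ler_wiXn2l ?invr_ge0 ?invf_le1 ?ler1n //.
rewrite ltnNge; apply/negP => mn; apply: nVm.
exact: (Vle _ _ (leqW mn) _ Vgh).
Qed.

Definition right_cauchy_nbhs (u : nat -> G) :=
  forall V : set G, nbhs (1%g : G) V ->
    exists N, forall i j, (N <= i)%N -> (N <= j)%N -> V (u i * (u j)^-1)%g.

(** Right invariance gives [d 1 (g * h^-1) = d h g], so such a metric sees exactly the quotients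
    [u i * (u j)^-1]. The converse takes its metric from [right_invariant_metric]. *)
Lemma right_cauchyP u : polish R G -> right_cauchy R u <-> right_cauchy_nbhs u.
Proof.
move=> pG; split=> [[d [[md dn] dr uC]] V /dn[e e0 eV]|uC].
  have [N hN] := uC e e0; exists N => i j Ni Nj; apply: eV => /=.
  by have := dr 1%g (u i * (u j)^-1)%g (u j); rewrite mul1g mulgVK => <-; exact: hN.
have [d cd dr] := right_invariant_metric pG; exists d; split => // e e0.
have [N hN] := uC _ (nbhs_metric_ball 1%g cd e0); exists N => i j Ni Nj.
have := hN j i Nj Ni; rewrite /=.
by have := dr 1%g (u j * (u i)^-1)%g (u i); rewrite mul1g mulgVK => <-.
Qed.

End topological_groups.

(** * Generic continuity of homomorphisms *)

Section continuous_actions.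
Context {G : topologicalGroupType} {X : topologicalType}.
Context (a : continuous_action G X).

Lemma act_continuousr g : continuous (a g).
Proof. exact: (continuous_slices (@act_continuous _ _ a)).1. Qed.

Lemma act_continuousl x : continuous (fun g => a g x).
Proof. exact: (continuous_slices (@act_continuous _ _ a)).2. Qed.

Lemma actK g x : a g^-1%g (a g x) = x.
Proof. by rewrite -actMx mulVg act1x. Qed.

Lemma actVK g x : a g (a g^-1%g x) = x.
Proof. by rewrite -actMx mulgV act1x. Qed.

Lemma act_image_nbhs g x (U : set X) : nbhs x U -> nbhs (a g x) (a g @` U).
Proof.
rewrite -{1}(actK g x) => nU.
have nU' : nbhs (a g x) [set y | U (a g^-1%g y)] := act_continuousr nU.
by apply: filterS nU' => y Uy; exists (a g^-1%g y) => //; rewrite actVK.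
Qed.

Lemma act_pair_open (p : G * X) U : nbhs p U ->
  nbhs (a p.1 p.2) ((fun p => a p.1 p.2) @` U).
Proof.
move=> /nbhs_prodP[V [W [nV nW VW]]].
apply: filterS (act_image_nbhs p.1 nW) => _ [y Wy <-].
by exists (p.1, y) => //; apply: VW => //; exact: nbhs_singleton nV.
Qed.

Let shear_continuous (s : G -> G) : continuous s ->
  continuous (fun p : G * X => (p.1, a (s p.1) p.2)).
Proof.
move=> cs [g x] U /nbhs_prodP[A [B [/= nA nB AB]]].
have /nbhs_prodP[A' [B' [/= nA' nB' AB']]] :=
  @act_continuous _ _ a (s g, x) B nB.
apply/nbhs_prodP; exists (A `&` s @^-1` A'), B'; split=> //.
  by apply: filterI => //; exact: cs.
by move=> h y [/= Ah sh] By; apply: AB => //; exact: AB'.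
Qed.

Lemma shearV_continuous : continuous (fun p : G * X => (p.1, a p.1^-1%g p.2)).
Proof. exact/shear_continuous/invg_continuous. Qed.

Lemma shearV_open (p : G * X) U : nbhs p U ->
  nbhs (p.1, a p.1^-1%g p.2) ((fun p => (p.1, a p.1^-1%g p.2)) @` U).
Proof.
case: p => g x /=; rewrite -{1}(actVK g x) => nU.
have nU' : nbhs (g, a g^-1%g x) [set q : G * X | U (q.1, a q.1 q.2)] :=
  @shear_continuous id (fun x => @cvg_id _ _) (g, a g^-1%g x) U nU.
by apply: filterS nU' => -[h y] Uy; exists (h, a h y) => //=; rewrite actK.
Qed.

(** The Vaught transform of [A]. The action map is continuous and open, so the pairs [(g, x)] with
    [g x] in [A] are comeager, and Kuratowski-Ulam applies. *)
Lemma generic_orbit_comeager (B : nat -> set G) (A : set X) :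
  enum_base B -> comeager A -> comeager [set x | comeager [set g | A (a g x)]].
Proof.
move=> baseB cA; apply: (kuratowski_ulam (A := [set p | A (a p.1 p.2)]) baseB).
exact: comeager_preimage (@act_continuous _ _ a) act_pair_open cA.
Qed.

(** The map [(g, x)] to [(g, g^-1 x)] is a homeomorphism, so it preserves category. The lemma serves
    to write a generic [y] as [g x] with [(g, x)] generic. *)
Lemma generic_shear_comeager (B : nat -> set G) (A : set (G * X)) :
  enum_base B -> comeager A ->
  comeager [set x | comeager [set g | A (g, a g^-1%g x)]].
Proof.
move=> baseB cA.
apply: (kuratowski_ulam (A := [set p | A (p.1, a p.1^-1%g p.2)]) baseB).
exact: comeager_preimage shearV_continuous shearV_open cA.
Qed.

Lemma orbit_rel_refl x : orbit_rel a x x.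
Proof. by exists 1%g => //; rewrite act1x. Qed.

Lemma orbit_rel_sym x y : orbit_rel a x y -> orbit_rel a y x.
Proof. by move=> [g _ <-]; exists g^-1%g => //; rewrite actK. Qed.

Lemma orbit_rel_trans x y z :
  orbit_rel a x y -> orbit_rel a y z -> orbit_rel a x z.
Proof. by move=> [g _ <-] [h _ <-]; exists (h * g)%g => //; rewrite actMx. Qed.

Lemma gorbit_eqP x y : gorbit a x = gorbit a y <-> orbit_rel a x y.
Proof.
split=> [xy|xy]; first by rewrite /orbit_rel xy; exact: orbit_rel_refl.
apply/seteqP; split=> z; last exact: orbit_rel_trans.
by apply: orbit_rel_trans; exact: orbit_rel_sym.
Qed.

End continuous_actions.

Lemma comeager_mulgr (G : topologicalGroupType) (A : set G) g :
  comeager A -> comeager [set k | A (k * g)%g].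
Proof.
apply: comeager_preimage (@mulgr_continuous G g) _ => h U.
exact: mulgr_open.
Qed.

Section right_embeddings.
Context {R : realType} {G : topologicalGroupType} {X : topologicalType}.
Context (a : continuous_action G X).
Hypothesis polishG : polish R G.

(** Replacing [u i] by [g * u i * g'^-1] conjugates the quotients [u i * (u j)^-1] by the fixed
    element [g], and conjugation is continuous at [1]. *)
Lemma right_embeds_act g g' x x' :
  right_embeds R a x x' -> right_embeds R a (a g x) (a g' x').
Proof.
move=> [u /(right_cauchyP _ polishG) uC ux].
exists (fun i => g * u i * g'^-1)%g.
  apply/(right_cauchyP _ polishG) => V /(nbhs1_conj g)/uC[N hN].
  exists N => i j Ni Nj; have := hN i j Ni Nj.
  by rewrite /= mulgKA invgM !mulgA.
have -> : (fun i => a (g * u i * g'^-1)%g (a g' x')) = a g \o (fun i => a (u i) x').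
  by apply/funext => i /=; rewrite !actMx actK.
exact: cvg_comp ux (@act_continuousr _ _ a g x).
Qed.

Lemma right_embeds_orbit x x' y y' : orbit_rel a x y -> orbit_rel a x' y' ->
  right_embeds R a x x' -> right_embeds R a y y'.
Proof. by move=> [g _ <-] [g' _ <-]; exact: right_embeds_act. Qed.

Lemma right_embeds_refl x : right_embeds R a x x.
Proof.
exists (fun=> 1%g); first apply/(right_cauchyP _ polishG) => V V1.
  by exists 0%N => *; rewrite mulgV; exact: nbhs_singleton.
by rewrite act1x; exact: cvg_cst.
Qed.

End right_embeddings.

(** * Measurable cocycles and the transfer of right-embeddings *)

Section generic_homomorphisms.
Context {R : realType} {G H : topologicalGroupType} {X Y : topologicalType}.
Hypotheses (polishG : polish R G) (polishH : polish R H)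
  (polishX : polish R X) (polishY : polish R Y).
Context (a : continuous_action G X) (b : continuous_action H Y) (f : X -> Y).
Hypothesis f_baire : baire_measurable f.
Hypothesis f_hom : forall x x', orbit_rel a x x' -> orbit_rel b (f x) (f x').

(** The equation [h (f x) = f (g x)] is solvable in [h] because [f] is a homomorphism, and
    [baire_selection] solves it measurably. The approximation [E s] asks that [f (g x)] be in the
    closure of the translates of [f x] by [K s]. *)
Lemma baire_cocycle : exists2 h : G * X -> H, baire_measurable h
  & comeager [set p | b (h p) (f p.2) = f (a p.1 p.2)].
Proof.
have [BG baseG] := polish_enum_base polishG.
have [BX baseX] := polish_enum_base polishX.
have [BY baseY] := polish_enum_base polishY.
have [BGX baseGX] := enum_base_prod baseG baseX.
have [K [K0 KS Klim]] :=
  closed_scheme (U := fun=> setT) polishH (fun=> openT).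
pose E s := [set p : G * X |
  closure [set b h (f p.2) | h in K s] (f (a p.1 p.2))].
pose rel (p : G * X) h := b h (f p.2) = f (a p.1 p.2).
have [_ _ [d cd _]] := polishY.
have [|||||h [bh _ hP]] := baire_selection baseGX 1%g (K := K) (E := E) (R := rel).
- by move=> *; rewrite K0.
- by move=> s t z _ Kz; have [//|n []] := KS s z _ Kz; exists n.
- by move=> s p h; rewrite /rel /E /= => <- Kh; apply: subset_closure; exists h.
- move=> s; rewrite -(setCK (E s)); apply: baire_propertyC.
  (* The complement of [N n] is a union of preimages of [BY n] under translations, hence open
     whatever [K s] is. *)
  pose N n := [set y : Y | forall h, K s h -> ~ BY n (b h y)].
  have -> : ~` E s = \bigcup_n ([set p | BY n (f (a p.1 p.2))] `&`
      [set p | N n (f p.2)]).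
    apply/seteqP; split=> [p|p [n _ [Bn Nn]] Ep]; last first.
      have [_ [[h Kh <-]]] := Ep _ (open_nbhs_nbhs (conj (baseY.1 n) Bn)).
      exact: Nn.
    move=> /= nE; apply: contrapT => h; apply: nE => U /baseY.2[n [Bn BU]].
    apply: contrapT => h'; apply: h; exists n => //; split => // k Kk Bk.
    by apply: h'; exists (b k (f p.2)); split; [exists k|exact: BU].
  apply: baire_property_bigcup => n; apply: baire_propertyI.
    apply: (baire_property_preimage (A := f @^-1` BY n)
      (@act_continuous _ _ a) (@act_pair_open _ _ a)).
    by apply: f_baire; exact: baseY.1.
  apply: (baire_property_preimage (A := f @^-1` N n)
    (@snd_continuous G X) (@snd_image_nbhs G X)).
  suff bN : baire_property (~` (f @^-1` N n)).
    by rewrite -(setCK (f @^-1` N n)); exact: baire_propertyC.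
  apply: (f_baire (U := ~` N n)).
  rewrite (_ : ~` N n = \bigcup_(h in K s) b h @^-1` BY n).
    apply: bigcup_open => h _; apply: open_comp; last exact: baseY.1.
    by move=> y _; exact: act_continuousr.
  apply/seteqP; split=> [y /existsNP[h /not_implyP[Kh /contrapT Bh]]|y].
    by exists h.
  by move=> [h Kh Bh] /(_ h Kh).
- move=> p s bs Es; have [|q [_ Kq Nq]] := Klim s bs.
    by move=> k; have [_ [[h Kh _] _]] := Es k _ filterT; exists h.
  (* If [q] sent [f x] to a point at distance [e > 0] from [f (g x)], a cell moving [f x] to within
     [e / 2] of that point could not also come within [e / 2] of [f (g x)]. *)
  exists q; split=> //; apply: contrapT => /eqP qf.
  pose e := d (b q (f p.2)) (f (a p.1 p.2)).
  have e0 : 0 < e.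
    rewrite lt_def metric_ge0 ?andbT; last exact: cd.1.
    by apply: contra_neq qf => /(metric_separated cd.1).
  have e20 : 0 < e / 2 by rewrite divr_gt0.
  have [k Kk] := Nq _ (act_continuousl (nbhs_metric_ball (b q (f p.2)) cd e20)).
  have [_ [[h /Kk/= qh <-] /= hf]] := Es k _ (nbhs_metric_ball _ cd e20).
  have := metric_triangular cd.1 (b q (f p.2)) (b h (f p.2)) (f (a p.1 p.2)).
  rewrite (metric_symmetric cd.1 (b h (f p.2))) -/e; lra.
exists h => //; apply: comeagerS hP => p; apply.
by have [k _ kf] := f_hom (ex_intro2 _ _ p.1 Logic.I (erefl (a p.1 p.2))); exists k.
Qed.

(** Write [y = g0 x0] with [(g0, x0)] a continuity point of the cocycle [h]. For [z] near [y], [g]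
    near [g0] and [k] near [1], with [x = g^-1 z], both [h (k g, x)] and [h (g, x)] are near
    [h (g0, x0)], so their quotient, which takes [f z] to [f (k z)], is near [1]. *)
Lemma orbit_continuity : exists C : set X, [/\ comeager C, continuous_rel C f,
    forall y, C y -> comeager [set g | C (a g y)]
  & forall y (W : set H), C y -> nbhs (1%g : H) W -> exists U V,
      [/\ nbhs y U, nbhs (1%g : G) V & forall z, U z -> C z ->
        comeager [set g | V g -> exists2 w, W w & f (a g z) = b w (f z)]]].
Proof.
have [BG baseG] := polish_enum_base polishG.
have [BH baseH] := polish_enum_base polishH.
have [BY baseY] := polish_enum_base polishY.
have [h bh hP] := baire_cocycle.
have [Cf cCf Cfc] := baire_measurable_continuous baseY f_baire.
have [Qh cQh Qhc] := baire_measurable_continuous baseH bh.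
pose Q := Qh `&` [set p | b (h p) (f p.2) = f (a p.1 p.2)].
have cQ : comeager Q by exact: comeagerI.
have Qc : continuous_rel Q h by apply: continuous_relS Qhc => p [].
pose Q1 := [set x | comeager [set g | Q (g, x)]].
have cQ1 : comeager Q1 := kuratowski_ulam baseG cQ.
(* The second condition supplies the base point [g0]; the third allows [g] to be chosen with
   [(k, g^-1 y)] in [Q] for generic [k]. *)
pose C0 := Cf `&` [set y | comeager [set g | Q (g, a g^-1%g y)]]
  `&` [set y | comeager [set g | Q1 (a g^-1%g y)]].
have cC0 : comeager C0.
  apply: comeagerI; first apply: comeagerI => //.
    exact: generic_shear_comeager baseG cQ.
  have cQ2 : comeager ((@snd G X) @^-1` Q1).
    exact: comeager_preimage (@snd_continuous G X) (@snd_image_nbhs G X) cQ1.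
  exact: (generic_shear_comeager a baseG cQ2).
(* Intersecting with [C1] makes the final set stable under generic translations. *)
pose C1 := [set y | comeager [set g | C0 (a g y)]].
have cC1 : comeager C1 by exact: generic_orbit_comeager baseG cC0.
exists (C0 `&` C1); split.
- exact: comeagerI.
- by apply: continuous_relS Cfc => y [[[]]].
- move=> y [_ C1y]; apply: comeagerI => //.
  apply: comeagerS comeagerT => g _ /=; rewrite /C1 /=.
  have := comeager_mulgr g C1y; apply: comeagerS => k /=.
  by rewrite actMx.
move=> y W [[[_ Qy] _] _] /nbhs1_mulgV[W0 nW0 W0W].
have [g0 [_ Qg0]] := comeager_meets (x := 1%g) polishG Qy filterT.
set x0 := a g0^-1%g y in Qg0; set h0 := h (g0, x0).
have [O nO OW] := Qc _ Qg0 _ (nbhs_divr h0 nW0).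
have [O1 [O2 [/= nO1 nO2 O12]]] := (nbhs_prodP _ _).1 nO.
have {}nO1 : nbhs ((1%g : G, g0).1 * (1%g : G, g0).2)%g O1 by rewrite /= mul1g.
have [V [O1' [/= nV nO1' VO1]]] := (nbhs_prodP _ _).1 (@mulg_continuous G _ _ nO1).
have nO12 : nbhs (g0, a g0^-1%g y) (setT `*` O2).
  by apply/nbhs_prodP; exists setT, O2; split => //; exact: filterT.
have [O3 [U [/= nO3 nU O3U]]] :=
  (nbhs_prodP _ _).1 (@shearV_continuous _ _ a (g0, y) _ nO12).
exists U, V; split=> // z Uz [[[_ Qz] Q1z] _].
have nO' : nbhs g0 (O1' `&` O3) by exact: filterI.
have [g [[O1g O3g] [Qg Q1g]]] := comeager_meets polishG (comeagerI Qz Q1z) nO'.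
set x := a g^-1%g z in Qg Q1g; have gx : a g x = z by rewrite /x actVK.
have O2x : O2 x by have [] := O3U _ _ O3g Uz.
apply: comeagerS (comeager_mulgr g Q1g) => k Qk Vk.
have O1k : O1 (k * g)%g by exact: VO1.
have O1g' : O1 g by rewrite -(mul1g g); apply: VO1 => //; exact: nbhs_singleton nV.
have Wk := W0W _ _ (OW _ (O12 _ _ O1k O2x) Qk) (OW _ (O12 _ _ O1g' O2x) Qg).
exists (h ((k * g)%g, x) * (h (g, x))^-1)%g; first by rewrite mulgKA in Wk.
have [_ /= hk] := Qk; have [_ /=] := Qg; rewrite gx => <-.
by rewrite -actMx mulgVK hk actMx gx.
Qed.

(** A perturbed sequence [p] moves [x'] through [C] towards [x]. The step from [p k] to [p k.+1]
    moves the [f]-image by some [w k] within [2^-k] of [1], so the products of the [w k] form a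
    right-Cauchy sequence, and continuity of [f] on [C] at [x] identifies the limit. *)
Lemma generic_right_embeds : exists C : set X, [/\ comeager C,
    forall y, C y -> comeager [set g | C (a g y)]
  & forall x x', C x -> C x' -> right_embeds R a x x' ->
      right_embeds R b (f x) (f x')].
Proof.
have [C [cC Cc CG CW]] := orbit_continuity.
exists C; split=> // x x' Cx Cx' [c /(right_cauchyP _ polishG) cauc cx].
have [dH cdH rdH] := right_invariant_metric polishH; have mdH := cdH.1.
have [_ _ [dY cdY _]] := polishY.
pose eps k : R := 2^-1 ^+ k.
have eps0 k : 0 < eps k by rewrite exprn_gt0 // invr_gt0.
have /choice[U] k : exists U : set X, nbhs x U /\ exists V : set G, [/\ open V, V 1%g,
    forall z, U z -> C z -> comeager [set g | V g ->
      exists2 w, dH 1%g w < eps k & f (a g z) = b w (f z)]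
    & forall z, U z -> C z -> dY (f x) (f z) < k.+1%:R^-1].
  have [U [V [nU nV UV]]] := CW x _ Cx (nbhs_metric_ball 1%g cdH (eps0 k)).
  have k0 : 0 < k.+1%:R^-1 :> R by rewrite invr_gt0.
  have [U' nU' U'Y] := Cc x Cx _ (nbhs_metric_ball (f x) cdY k0).
  exists (U `&` U'); split; first exact: filterI.
  exists (V°); split; [exact: open_interior|exact: nV| |].
    move=> z [Uz _] Cz; apply: comeagerS (UV z Uz Cz) => g gP /interior_subset.
    exact: gP.
  by move=> z [_ U'z] Cz; exact: U'Y.
move=> /all_and2[nU /choice[V VP]].
have /choice[N NP] k : exists N : nat, forall i, (N <= i)%N ->
    (U k)° (a (c i) x') /\ forall j, (N <= j)%N -> V k (c i * (c j)^-1)%g.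
  have [oV V1 _ _] := VP k.
  have [N1 hN1] := cauc (V k) (open_nbhs_nbhs (conj oV V1)).
  have [N2 _ hN2] := cx _ (nbhs_interior (nU k)).
  exists (maxn N1 N2) => i; rewrite geq_max => /andP[i1 i2]; split.
    exact: hN2.
  by move=> j; rewrite geq_max => /andP[j1 _]; exact: hN1.
(* Partial sums give indices that increase with [k] and dominate [N k], so [M k] and [M k.+1] both
   lie beyond [N k]. *)
pose M k := (\sum_(i < k.+1) N i)%N.
have NM k : (N k <= M k)%N by rewrite /M big_ord_recr leq_addl.
have MS k : (M k <= M k.+1)%N by rewrite {2}/M big_ord_recr leq_addr.
pose e k := c (M k).
have eU k : (U k)° (a (e k) x') by have [] := NP k _ (NM k).
have eV k : V k (e k.+1 * (e k)^-1)%g.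
  by have [_] := NP k (M k.+1) (leq_trans (NM k) (MS k)); apply.
(* The sequence [p] stays close to [e] but keeps every [p k x'] generic. *)
pose good k p := [/\ C (a p x'), (U k)° (a p x') & V k (e k.+1 * p^-1)%g].
have near_e k : nbhs (e k) [set p | (U k)° (a p x') /\ V k (e k.+1 * p^-1)%g].
  apply: filterI.
    apply: (@act_continuousl _ _ a x' (e k)).
    exact: open_nbhs_nbhs (conj (open_interior _) (eU k)).
  have [oV _ _ _] := VP k.
  have cont : continuous (fun p : G => (e k.+1 * p^-1)%g).
    move=> p; apply: (continuous_comp (@invg_continuous G p)).
    exact: mulgl_continuous.
  by apply: cont; apply: open_nbhs_nbhs; split => //; exact: eV.
have [p0 good0] : exists p, good 0%N p.
  by have [p [[? ?] ?]] := comeager_meets polishG (CG _ Cx') (near_e 0%N); exists p.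
(* The next element is taken near [e k.+1], generic both for [C] and, after right translation by
   [p^-1], for the small-motion property at [a p x']. *)
have /choice[next nextP] (kp : nat * G) : exists p', good kp.1 kp.2 ->
    good kp.1.+1 p' /\ exists2 w, dH 1%g w < eps kp.1
      & f (a p' x') = b w (f (a kp.2 x')).
  case: kp => k p /=; have [[Cp Up Vp]|?] := pselect (good k p); last by exists p.
  have [oV _ VW _] := VP k.
  have cp := comeager_mulgr p^-1%g (VW _ (interior_subset Up) Cp).
  have nV : nbhs (e k.+1) [set p' | V k (p' * p^-1)%g].
    by apply: (@mulgr_continuous G p^-1%g); exact: open_nbhs_nbhs.
  have nn : nbhs (e k.+1) ([set p' | V k (p' * p^-1)%g] `&`
      [set p | (U k.+1)° (a p x') /\ V k.+1 (e k.+2 * p^-1)%g]).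
    by apply: filterI => //; exact: near_e.
  have [p' [[Vp' [Up' Vp'']] [Cp' /(_ Vp')[w wP pw]]]] :=
    comeager_meets polishG (comeagerI (CG _ Cx') cp) nn.
  exists p' => _; split=> //; exists w => //.
  by rewrite -pw -actMx mulgVK.
pose p := fix p k := if k is k'.+1 then next (k', p k') else p0.
have pG k : good k (p k).
  by elim: k => [//|k IH]; have [] := nextP (k, p k) IH.
have /choice[w wP] k : exists w, dH 1%g w < eps k
    /\ f (a (p k.+1) x') = b w (f (a (p k) x')).
  by have [_ [w ? ?]] := nextP (k, p k) (pG k); exists w.
have [h0 _ h0P] := f_hom (ex_intro2 _ _ (p 0%N) Logic.I (erefl (a (p 0%N) x'))).
pose h := fix h k := if k is k'.+1 then (w k' * h k')%g else h0.
have hP k : b (h k) (f x') = f (a (p k) x').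
  by elim: k => [//|k IH]; rewrite (wP k).2 -IH -actMx.
(* Right invariance turns the size of [w k] into the distance between consecutive products. *)
have hS k : dH (h k) (h k.+1) < eps k.
  have := rdH 1%g (w k) (h k); rewrite mul1g => ->.
  exact: (wP k).1.
have epsS k : eps k.+1 = eps k / 2 by rewrite /eps exprS mulrC.
have h_tail i k : dH (h i) (h (k + i)%N) <= 2 * eps i - 2 * eps (k + i)%N.
  elim: k => [|k IH]; first by rewrite add0n (metric_refl mdH) subrr.
  rewrite addSn epsS; have := metric_triangular mdH (h i) (h (k + i)%N) (h (k + i).+1).
  have := hS (k + i)%N; lra.
have h_le N0 i : (N0 <= i)%N -> dH (h N0) (h i) < 2 * eps N0.
  by move=> /subnK <-; have := h_tail N0 (i - N0)%N; have := eps0 (i - N0 + N0)%N; lra.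
exists h.
  exists dH; split=> // r r0.
  (* With [eps n <= r / 4], both distances to [h n] are below [r / 2]. *)
  have [|n nr] := @half_expr_le R (r / 4); first lra.
  exists n => i j /h_le ni /h_le nj.
  have := metric_triangular mdH (h i) (h n) (h j).
  rewrite (metric_symmetric mdH (h i) (h n)); rewrite -/(eps n) in nr; lra.
move=> A /cdY.2[r /invSn_lt[n nr] rA].
exists n => // k /= nk; rewrite hP; apply: rA => /=.
have [Cp Up _] := pG k; have [_ _ _ VY] := VP k.
apply: lt_trans (VY _ (interior_subset Up) Cp) _.
by apply: le_lt_trans nr; rewrite lef_pV2 ?posrE // ler_nat.
Qed.

(** Right-embedding depends on orbits only, so points of the Vaught transform of [C] may be replaced
    by translates lying in [C]. *)
Lemma invariant_right_embeds :
  exists C : set X, [/\ comeager C, Defs.invariant a C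
  & forall x x', C x -> C x' -> right_embeds R a x x' ->
      right_embeds R b (f x) (f x')].
Proof.
have [BG baseG] := polish_enum_base polishG.
have [C [cC _ Cf]] := generic_right_embeds.
exists [set x | comeager [set g | C (a g x)]]; split.
- exact: generic_orbit_comeager baseG cC.
- move=> g x Cx; apply: comeagerS (comeager_mulgr g Cx) => k /=.
  by rewrite actMx.
move=> x x' Cx Cx' xx'.
have [g [_ Cg]] := comeager_meets (x := 1%g) polishG Cx filterT.
have [g' [_ Cg']] := comeager_meets (x := 1%g) polishG Cx' filterT.
apply: (right_embeds_orbit polishH) (Cf _ _ Cg Cg' (right_embeds_act polishG g g' xx')).
  by apply: orbit_rel_sym; apply: f_hom; exists g.
by apply: orbit_rel_sym; apply: f_hom; exists g'.
Qed.

End generic_homomorphisms.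

(** * Reductions and dimensions *)

Lemma polish_prod (R : realType) (S T : topologicalType) :
  polish R S -> polish R T -> polish R (S * T)%type.
Proof.
move=> [[x0 _] [D cD dD] [d [md dn] dc]] [[y0 _] [D' cD' dD'] [d' [md' dn'] dc']].
split; first by exists (x0, y0).
  exists (D `*` D'); first exact: countableX.
  move=> O [[x y] Oxy] oO.
  have [A [B [/= nA nB AB]]] := (nbhs_prodP _ _).1 (open_nbhs_nbhs (conj oO Oxy)).
  have [u [Au Du]] := dense_nbhs dD nA; have [v [Bv Dv]] := dense_nbhs dD' nB.
  by exists (u, v); split; [exact: AB|].
pose d2 (p q : S * T) := d p.1 q.1 + d' p.2 q.2.
have d0 x y : 0 <= d x y by exact: metric_ge0.
have d'0 x y : 0 <= d' x y by exact: metric_ge0.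
exists d2.
  split; first split; rewrite /d2.
  - by move=> [x y]; rewrite (metric_refl md) (metric_refl md') addr0.
  - move=> [x y] [u v] /= h; congr pair.
      by apply: (metric_separated md); have := d0 x u; have := d'0 y v; lra.
    by apply: (metric_separated md'); have := d0 x u; have := d'0 y v; lra.
  - by move=> [x y] [u v]; rewrite (metric_symmetric md) (metric_symmetric md').
  - move=> [x y] [u v] [w z] /=; have := metric_triangular md x u w.
    have := metric_triangular md' y v z; lra.
  move=> [x y] A; split.
    move=> /nbhs_prodP[V [W [/= /dn[e e0 eV] /dn'[r r0 rW] VW]]].
    exists (Num.min e r); first by rewrite lt_min e0.
    move=> [u v]; rewrite /d2 /= lt_min => /andP[h1 h2].
    by apply: VW; [apply: eV|apply: rW] => /=; have := d0 x u; have := d'0 y v; lra.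
  move=> [e e0 eA]; have e20 : 0 < e / 2 by lra.
  apply/nbhs_prodP; exists [set u | d x u < e / 2], [set v | d' y v < e / 2].
  split=> /=; [by apply/dn; exists (e / 2)|by apply/dn'; exists (e / 2)|].
  by move=> u v xu yv; apply: eA; rewrite /d2 /=; lra.
move=> u uC; have [|x ux] := dc (fst \o u).
  move=> e /uC[N hN]; exists N => i j /hN h /h; rewrite /d2 /=.
  by have := d'0 (u i).2 (u j).2; lra.
have [|y uy] := dc' (snd \o u).
  move=> e /uC[N hN]; exists N => i j /hN h /h; rewrite /d2 /=.
  by have := d0 (u i).1 (u j).1; lra.
exists (x, y) => A /nbhs_prodP[V [W [/= /ux nV /uy nW VW]]].
have nVW : \forall i \near \oo, V (u i).1 /\ W (u i).2 by exact: filterI.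
apply: filterS nVW => i [Vu Wu]; have := VW _ _ Vu Wu.
by rewrite -surjective_pairing.
Qed.

(** * Measurable inverses of reductions *)

Section star_reductions.
Context {R : realType} {G H : topologicalGroupType} {X Y : topologicalType}.
Hypotheses (polishG : polish R G) (polishH : polish R H)
  (polishX : polish R X) (polishY : polish R Y).
Context (a : continuous_action G X) (b : continuous_action H Y) (f : X -> Y).

(** [Z] is a G-delta set on which [f] is continuous, so [A] is the image of all pairs [(h, x)] with
    [x] in [Z] under the continuous map to [h (f x)]. A selection of such pairs, projected to [X],
    inverts [f] up to orbits. *)
Lemma image_saturation_selection (C : set X) :
  baire_measurable f -> comeager C ->
  exists Z : set X, [/\ Z `<=` C, comeager Z &
  let A := [set y | exists2 x, Z x & orbit_rel b (f x) y] in
  baire_property A /\ exists2 g : Y -> X, baire_measurable g &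
    comeager [set y | A y -> Z (g y) /\ orbit_rel b (f (g y)) y]].
Proof.
move=> f_baire cC; have [BY baseY] := polish_enum_base polishY.
have [Cf cCf Cfc] := baire_measurable_continuous baseY f_baire.
have [U [oU cU UC]] := comeager_Gdelta (comeagerI cC cCf).
set Z := \bigcap_k U k in cU UC; exists Z; split=> //; first by move=> x /UC[].
move=> A; have [|K [K0 KS Klim]] :=
    closed_scheme (U := fun k => (@snd H X) @^-1` U k) (polish_prod polishH polishX).
  by move=> k; apply: open_comp => // p _; exact: snd_continuous.
pose E s := closure [set b p.1 (f p.2) | p in K s `&` (@snd H X) @^-1` Z].
pose rel y (p : H * X) := Z p.2 /\ b p.1 (f p.2) = y.
have [x0 _] : [set: X] !=set0 by case: polishX.
have [_ _ [d cd _]] := polishY.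
have [|||||g [bg bA gP]] := baire_selection baseY (1%g, x0) (K := K) (E := E) (R := rel).
- by move=> *; rewrite K0.
- move=> s y p [Zp _] Kp; have [|n []] := KS s p _ Kp; first exact: Zp.
  by exists n.
- by move=> s y p [Zp <-] Kp; apply: subset_closure; exists p.
- move=> s; rewrite -(setCK (E s)); apply/baire_propertyC/open_baire_property.
  exact/closed_openC/closed_closure.
- move=> y s bs Es; have [|p [Up Kp Np]] := Klim s bs.
    by move=> k; have [_ [[p [Kp _] _] _]] := Es k _ filterT; exists p.
  have Zp : Z p.2 by move=> k _; exact: Up.
  (* As for the cocycle, but both coordinates vary: joint continuity of the action and continuity of
     [f] on [Z] control the error. *)
  exists p; split=> //; split=> //; apply: contrapT => /eqP py.
  pose e := d (b p.1 (f p.2)) y.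
  have e0 : 0 < e.
    rewrite lt_def metric_ge0 ?andbT; last exact: cd.1.
    by apply: contra_neq py => /(metric_separated cd.1).
  have e20 : 0 < e / 2 by rewrite divr_gt0.
  have /nbhs_prodP[V [W [/= nV nW VW]]] := @act_continuous _ _ b (p.1, f p.2) _
    (nbhs_metric_ball (b p.1 (f p.2)) cd e20).
  have [W' nW' W'W] := Cfc _ (UC _ Zp).2 _ nW.
  have [|k Kk] := Np (V `*` W').
    by apply/nbhs_prodP; exists V, W'; split.
  have [_ [[q [/Kk[Vq Wq] Zq] <-] /= qy]] := Es k _ (nbhs_metric_ball y cd e20).
  have := VW _ _ Vq (W'W _ Wq (UC _ Zq).2); rewrite /=.
  have := metric_triangular cd.1 (b p.1 (f p.2)) (b q.1 (f q.2)) y.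
  rewrite (metric_symmetric cd.1 y) in qy; rewrite -/e; lra.
have relA y : (exists p, rel y p) <-> A y.
  split=> [[p [Zp py]]|[x Zx [h _ hy]]]; last by exists (h, x).
  by exists p.2 => //; exists p.1.
split; first by apply: (baire_property_ae (N := set0) meager0 _ bA) => y _; split=> /relA.
exists (snd \o g) => [V oV|]; last first.
  apply: comeagerS gP => y h /relA /h[Zg gy].
  by split => //; exists (g y).1.
by apply: (bg (snd @^-1` V)); apply: open_comp => // p _; exact: snd_continuous.
Qed.

Hypothesis f_baire : baire_measurable f.
Hypothesis f_cat : category_preserving f.
Hypothesis f_red : forall x x', orbit_rel a x x' <-> orbit_rel b (f x) (f x').

(** The clause on [D] lets preimages be chosen in [C]; since right-embedding depends on orbits only,
    the equivalence stated for [C] then covers [D] too. *)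
Lemma reduction_right_embeds : exists (C : set X) (D : set Y),
  [/\ comeager C, Defs.invariant a C,
      [/\ Defs.invariant b D, ~ meager D & baire_property D],
      forall y, D y -> exists2 x, C x & orbit_rel b y (f x)
    & forall x x', C x -> C x' ->
        right_embeds R a x x' <-> right_embeds R b (f x) (f x')].
Proof.
have [C1 [cC1 iC1 C1f]] := 
  invariant_right_embeds polishG polishH polishX polishY f_baire
    (fun x x' => (f_red x x').1).
have [Z [ZC cZ]] := image_saturation_selection f_baire cC1.
set A := [set y | _] => /= -[bA [g bg gA]].
have [x0 _] : [set: X] !=set0 by case: polishX.
have fA : Z `<=` f @^-1` A by move=> x Zx; exists x => //; exists 1%g => //; rewrite act1x.
have iA : Defs.invariant b A.
  by move=> h y [x Zx xy]; exists x => //; apply: orbit_rel_trans xy _; exists h.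
(* The selector [g] is correct only generically, whereas a homomorphism is required everywhere. So
   [g'] keeps [g] where it is correct, takes any correct value at the other points of [A], which
   form a meager set, and is the constant [x0] off [A]. *)
have /choice[g' g'P] y : exists x, [/\ A y -> Z x /\ orbit_rel b (f x) y,
    ~ A y -> x = x0 & (A y -> Z (g y) /\ orbit_rel b (f (g y)) y) -> A y -> x = g y].
  have [Ay|nA] := pselect (A y); last by exists x0.
  have [gy|ngy] := pselect (Z (g y) /\ orbit_rel b (f (g y)) y); first by exists (g y).
  by have [x Zx xy] := Ay; exists x; split => // /(_ Ay).
have bg' : baire_measurable g'.
  move=> U oU; apply: (baire_property_ae (N := ~` [set y | A y -> Z (g y)
      /\ orbit_rel b (f (g y)) y]) (B := (A `&` g @^-1` U) `|`
      (~` A `&` [set _ | U x0]))) => //.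
    move=> y /contrapT gy; have [h1 h2 h3] := g'P y.
    have [Ay|nA] := pselect (A y); rewrite /= ?(h3 gy Ay) ?(h2 nA).
      by split=> [|[[]|[]]] //; left.
    by split=> [|[[]|[]]] //; right.
  apply: baire_propertyU; first by apply: baire_propertyI => //; exact: bg.
  apply: baire_propertyI; first exact: baire_propertyC.
  have [Ux|nU] := pselect (U x0).
    by rewrite (_ : mkset _ = setT); [exact/open_baire_property/openT|apply/seteqP; split].
  by rewrite (_ : mkset _ = set0); [exact/open_baire_property/open0|apply/seteqP; split].
have g'_hom y y' : orbit_rel b y y' -> orbit_rel a (g' y) (g' y').
  move=> yy'; have [h1 h2 _] := g'P y; have [h1' h2' _] := g'P y'.
  have [Ay|nA] := pselect (A y).
    have Ay' : A y' by case: yy' => h _ <-; exact: iA.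
    apply/f_red; apply: orbit_rel_trans (h1 Ay).2 _.
    exact: orbit_rel_trans yy' (orbit_rel_sym (h1' Ay').2).
  have nA' : ~ A y' by move=> Ay'; apply: nA; case: (orbit_rel_sym yy') => h _ <-; exact: iA.
  by rewrite h2 // h2' //; exists 1%g => //; rewrite act1x.
have [C2 [cC2 iC2 C2g]] := 
  invariant_right_embeds polishH polishG polishY polishX bg' g'_hom.
pose D := A `&` C2.
have iD : Defs.invariant b D by move=> h y [Ay Cy]; split; [exact: iA|exact: iC2].
(* The preimage of [A] contains [Z], and category preservation handles [C2]. *)
have cfD : comeager (f @^-1` D).
  apply: (comeagerI (A := f @^-1` A)); first exact: comeagerS cZ.
  exact: (f_cat (M := ~` C2)).
have fg' x : D (f x) -> orbit_rel a (g' (f x)) x.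
  by move=> [Ax _]; have [h _ _] := g'P (f x); apply/f_red; exact: (h Ax).2.
exists (C1 `&` f @^-1` D), D; split.
- exact: comeagerI.
- move=> h x [C1x Dx]; split; first exact: iC1.
  suff : D (f (a h x)) by [].
  have [k _ <-] := (f_red x (a h x)).1 (ex_intro2 _ _ h Logic.I erefl).
  exact: iD.
- split=> //; last first.
    by apply: baire_propertyI => //; rewrite -(setCK C2); exact/baire_propertyC/meager_baire_property.
  (* If [D] were meager, its comeager preimage would be meager too. *)
  move=> /f_cat mD; apply: (baire_category polishX openT); first by exists x0.
  by apply: meagerS (meagerU mD cfD) => x _; exact: EM.
- move=> y Dy; have [x Zx xy] := Dy.1; exists x; last exact: orbit_rel_sym.
  split; first exact: ZC.
  suff : D (f x) by [].
  by case: (orbit_rel_sym xy) => h _ <-; exact: iD.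
move=> x x' [C1x Dx] [C1x' Dx']; split; first exact: C1f.
(* Apply the inverse [g']: it returns [f x] to the orbit of [x]. *)
move=> /(C2g _ _ Dx.2 Dx'.2); apply: (right_embeds_orbit polishG); exact: fg'.
Qed.

End star_reductions.

(** * Cubes and dimension of orbit digraphs *)

Section orbit_digraphs.
Context {R : realType} {G : topologicalGroupType} {X : topologicalType}.
Hypothesis polishG : polish R G.
Context (a : continuous_action G X).

Lemma orbit_arrowP (C : set X) (u v : orbit_digraph R a C) x y :
  val u = gorbit a x -> val v = gorbit a y ->
  arrow u v <-> right_embeds R a x y.
Proof.
move=> ux vy; split=> [[x' [y' []]]|xy]; last by exists x, y.
rewrite ux vy => /esym/gorbit_eqP x'x /esym/gorbit_eqP y'y.
exact: right_embeds_orbit.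
Qed.

Lemma cube0_embeds (C : set X) :
  C !=set0 -> digraph_embeds (cube 0) (orbit_digraph R a C).
Proof.
move=> [x Cx]; have Ox : gorbit a x \in [set gorbit a x | x in C].
  by apply/mem_set; exists x.
have cube0 (s t : {set 'I_0}) : s = t by apply/setP => -[].
pose O : orbit_digraph R a C := SigSub Ox; exists (fun=> O); split=> [s t _|s t]; first exact: cube0.
rewrite (cube0 s t) /=; split=> // _.
by exists x, x; split => //; exact: right_embeds_refl.
Qed.

(** [dimension] is [Infty] whenever no largest cube exists, so one must be produced: the sizes are
    bounded by [m], and the 0-cube embeds in a non-empty [C]. *)
Lemma dimension_bound (C : set X) m : C !=set0 ->
  (forall k, digraph_embeds (cube k) (orbit_digraph R a C) -> (k <= m)%N) ->
  enat_le (dimension R a C) (Fin m).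
Proof.
move=> C0 Cm; rewrite /dimension; case: pselect => [ex|[]].
  by case: (cid ex) => k [+ _] /=; exact: Cm.
have ex : exists k, `[< digraph_embeds (cube k) (orbit_digraph R a C) >].
  by exists 0%N; apply/asboolP; exact: cube0_embeds.
have ub k : `[< digraph_embeds (cube k) (orbit_digraph R a C) >] -> (k <= m)%N.
  by move=> /asboolP; exact: Cm.
exists (ex_maxn ex ub); case: ex_maxnP => k /asboolP Ck kmax; split => // j Cj.
by apply: kmax; apply/asboolP.
Qed.

End orbit_digraphs.

Section digraph_embeddings.
Context {R : realType} {G H : topologicalGroupType} {X Y : topologicalType}.
Hypotheses (polishG : polish R G) (polishH : polish R H).
Context (a : continuous_action G X) (b : continuous_action H Y).

Lemma orbit_digraph_embeds (C : set X) (D : set Y) (F : X -> Y) :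
  (forall x, C x -> D (F x)) ->
  (forall x x', C x -> C x' -> orbit_rel a x x' <-> orbit_rel b (F x) (F x')) ->
  (forall x x', C x -> C x' ->
    right_embeds R a x x' <-> right_embeds R b (F x) (F x')) ->
  digraph_embeds (orbit_digraph R a C) (orbit_digraph R b D).
Proof.
move=> FCD Forb Femb.
have /choice[r rP] (u : orbit_digraph R a C) : exists x, C x /\ val u = gorbit a x.
  by have [x Cx <-] := set_mem (valP u); exists x.
have mF u : gorbit b (F (r u)) \in [set gorbit b y | y in D].
  by apply/mem_set; exists (F (r u)) => //; apply: FCD; exact: (rP u).1.
exists (fun u => SigSub (mF u) : orbit_digraph R b D); split=> [u v [uv]|u v].
  have [Cu ru] := rP u; have [Cv rv] := rP v.
  by apply: val_inj; rewrite ru rv; apply/gorbit_eqP/Forb => //; exact/gorbit_eqP.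
have [Cu ru] := rP u; have [Cv rv] := rP v.
rewrite (orbit_arrowP polishG ru rv) Femb //.
exact: iff_sym (orbit_arrowP polishH _ _).
Qed.

Lemma dimension_embeds (C : set X) (D : set Y) : C !=set0 ->
  digraph_embeds (orbit_digraph R a C) (orbit_digraph R b D) ->
  enat_le (dimension R a C) (dimension R b D).
Proof.
move=> C0 [f [f_inj f_arrow]]; rewrite {2}/dimension.
case: pselect => [ex|_]; last by case: (dimension _ _ _).
case: (cid ex) => m [_ mmax] /=; apply: dimension_bound => // k [g [g_inj g_arrow]].
apply: mmax; exists (f \o g); split=> [|u v]; first exact: inj_comp.
by rewrite g_arrow f_arrow.
Qed.

End digraph_embeddings.

Lemma enat_le_trans j k l : enat_le j k -> enat_le k l -> enat_le j l.
Proof. by case: j k l => [i|] [j|] [l|] //=; exact: leq_trans. Qed.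

Theorem theorem7 (R : realType) (G H : topologicalGroupType)
    (X Y : topologicalType)
    (polishG : polish R G) (polishH : polish R H)
    (polishX : polish R X) (polishY : polish R Y)
    (a : continuous_action G X) (b : continuous_action H Y) (n : enat) :
  (generically_dimensional R a n -> enat_lt (dimension R b [set: Y]) n ->
     ~ star_reduces (orbit_rel a) (orbit_rel b)) /\
  (enat_lt (dimension R a [set: X]) n -> locally_generically_dimensional R b n ->
     ~ star_reduces (orbit_rel a) (orbit_rel b)).
Proof.
(* One pair [C], [D] serves both parts: cubes of [C] pushed into [Y] refute (1), and cubes of [D]
   pulled back into [X] refute (2). *)
suff main : star_reduces (orbit_rel a) (orbit_rel b) ->
    exists (C : set X) (D : set Y), [/\ comeager C /\ Defs.invariant a C,
      [/\ Defs.invariant b D, ~ meager D & baire_property D],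
      enat_le (dimension R a C) (dimension R b [set: Y])
    & enat_le (dimension R b D) (dimension R a [set: X])].
  split=> [[an _] /negP bn|/negP an [bn _]] /main.
    move=> [C [D [[cC iC] _ CY _]]]; apply: bn.
    exact: enat_le_trans (an C iC cC) CY.
  move=> [C [D [_ [iD mD bD] _ DX]]]; apply: an.
  exact: enat_le_trans (bn D iD mD bD) DX.
move=> [f [f_baire f_cat f_red]].
have [C [D [cC iC [iD mD bD] DC Cf]]] :=
  reduction_right_embeds polishG polishH polishX polishY f_baire f_cat f_red.
have [x0 Cx0] : C !=set0.
  have [x0 _] : [set: X] !=set0 by case: polishX.
  by have [x [_ Cx]] := comeager_meets (x := x0) polishX cC filterT; exists x.
have D0 : D !=set0.
  apply: contrapT => D0; apply: mD; apply: (meagerS _ meager0) => y Dy.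
  by apply: D0; exists y.
(* A pointwise choice of preimages transports orbits and right-embeddings; off [D] its value is the
   default [x0]. *)
have /choice[g gP] y : exists x, D y -> C x /\ orbit_rel b y (f x).
  have [/DC[x Cx yx]|?] := pselect (D y); last by exists x0.
  by exists x.
exists C, D; split=> //.
  apply: dimension_embeds => //; first by exists x0.
  exact: (orbit_digraph_embeds polishG polishH (F := f)).
apply: dimension_embeds => //; apply: (orbit_digraph_embeds polishH polishG (F := g)) => //.
  move=> y y' /gP[_ yg] /gP[_ yg']; rewrite f_red; split=> yy'.
    by apply: orbit_rel_trans (orbit_rel_sym yg) _; exact: orbit_rel_trans yy' yg'.
  by apply: orbit_rel_trans yg _; exact: orbit_rel_trans yy' (orbit_rel_sym yg').
move=> y y' /gP[Cy yg] /gP[Cy' yg']; rewrite Cf //; split.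
  exact: right_embeds_orbit.
by apply: (right_embeds_orbit polishH); exact: orbit_rel_sym.
Qed.
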